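(* Let $T\in\mathcal{B}(l^2(\mathbb{N}))$ be an invertible operator (not necessarily normal) and suppose that there exists an orthogonal projection $P$ of rank $M$ (possibly infinite) such that both the ranges of $P$ and of $I-P$ are invariant under $T$. Suppose also that there exist $\alpha>\beta>0$ such that $\|Tx\|\ge\alpha\|x\|$ for all $x\in\mathrm{ran}(P)$ and $\|Tx\|\le\beta\|x\|$ for all $x\in\mathrm{ran}(I-P)$. Let $\{Q_n\}_{n\in\mathbb{N}}$ and $\{R_n\}_{n\in\mathbb{N}}$ be $Q$- and $R$-sequences of $T$ with respect to $\{e_i\}_{i\in\mathbb{N}}$. Then there exists a subset $\{\hat e_j\}_{j=1}^M\subset\{e_i\}_{i\in\mathbb{N}}$ such that: (i) For any finite $\mu\le M$ we have $\delta(\mathrm{span}\{Q_n\hat e_j\}_{j=1}^\mu,\mathrm{ran}(P))=O(\beta^n/\alpha^n)$ as $n\to\infty$. If $M$ is finite this implies full convergence $\hat\delta(\mathrm{span}\{Q_n\hat e_j\}_{j=1}^M,\mathrm{ran}(P))=O(\beta^n/\alpha^n)$ as $n\to\infty$. (ii) Every subsequence of $\{Q_n^*TQ_n\}_{n\in\mathbb{N}}$ has a convergent subsequence $\{Q_{n_k}^*TQ_{n_k}\}_{k\in\mathbb{N}}$ such that, in the weak operator topology, $$Q_{n_k}^*TQ_{n_k}\longrightarrow\sum_{j=1}^M\xi_j\otimes\hat e_j\bigoplus\sum_{i\in\Theta}\zeta_i\otimes e_i,\qquad k\to\infty,$$ where $\Theta=\{j:e_j\notin\{\hat e_l\}_{l=1}^M\}$,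 $\xi_j\in\overline{\mathrm{span}\{\hat e_l\}_{l=1}^M}$ and $\zeta_i\in\overline{\mathrm{span}\{e_l\}_{l\in\Theta}}$. If $\{Pe_l\}_{l=1}^M$ are linearly independent then we can take $\hat e_j=e_j$. Furthermore, if $T$ has only finitely many non-zero entries in each column, then weak operator convergence can be replaced by strong operator convergence.
   Context: $\{e_j\}_{j\in\mathbb{N}}$ is the canonical orthonormal basis of $l^2(\mathbb{N})$; inner products are linear in the first argument; $T$ is identified with the infinite matrix with entries $\langle Te_j,e_i\rangle$. For $u,v\in l^2(\mathbb{N})$, $u\otimes v$ denotes the operator $x\mapsto\langle x,v\rangle u$. $Q$- and $R$-sequences (IQR algorithm): an operator $R$ is upper triangular if $\langle Re_j,e_i\rangle=0$ for $i>j$. For invertible $T$, put $T_0=T$ and recursively take a QR decomposition $T_{m-1}=Q^{(m)}R^{(m)}$ ($Q^{(m)}$ unitary, $R^{(m)}$ upper triangular) and set $T_m=R^{(m)}Q^{(m)}$. Put $Q_n=Q^{(1)}\cdots Q^{(n)}$ and $R_n=R^{(n)}\cdots R^{(1)}$. Then $\{Q_n\}$ and $\{R_n\}$ are called a $Q$-sequence and an $R$-sequence of $T$; $T_n=Q_n^*TQ_n$ and $T^n=Q_nR_n$. For closed subspaces $M_1,M_2$ of $l^2(\mathbb{N})$, $\delta(M_1,M_2)=\sup_{x\in M_1,\|x\|=1}\inf_{y\in M_2}\|x-y\|$ and $\hat\delta(M_1,M_2)=\max\{\delta(M_1,M_2),\delta(M_2,M_1)\}$. *)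

(* Defs.v *)
From HB Require Import structures.
From mathcomp Require Import all_boot all_order all_algebra.
From mathcomp Require Import all_classical all_reals all_analysis.
From mathcomp Require Import complex ring lra.
Import Order.TTheory GRing.Theory Num.Theory numFieldNormedType.Exports.

Set Implicit Arguments.
Unset Strict Implicit.
Unset Printing Implicit Defensive.

Local Open Scope classical_set_scope.
Local Open Scope ring_scope.

(* The scalar field is R[i]; [R[i]^o] is the same type seen as a normed module
   over itself, which is where the library puts the topology of R[i]. *)

Section SquareSummable.
Variable R : realType.
Implicit Types (x y : nat -> R[i]) (a : R[i]).

Definition sqmod x : nat -> R := fun k => Normc.normc (x k) ^+ 2.

Definition square_summable : {pred nat -> R[i]} :=
  fun x => `[< cvgn (series (sqmod x)) >].

Lemma square_summableP x : x \in square_summable -> cvgn (series (sqmod x)).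
Proof. by rewrite /in_mem /= => /asboolP. Qed.

Lemma square_summableI x : cvgn (series (sqmod x)) -> x \in square_summable.
Proof. by move=> ?; rewrite /in_mem /=; apply/asboolP. Qed.

Lemma sqmod_ge0 x k : 0 <= sqmod x k. Proof. exact: sqr_ge0. Qed.

Lemma normc_ge0 (a : R[i]) : 0 <= Normc.normc a.
Proof. by case: a => u v; exact: sqrtr_ge0. Qed.

Lemma sqmod0 : sqmod 0 = 0.
Proof. by apply/funext => k; rewrite /sqmod Normc.normc0 expr0n. Qed.

Lemma sqmodZ a x : sqmod (a *: x) = Normc.normc a ^+ 2 *: sqmod x.
Proof. by apply/funext => k; rewrite /sqmod Normc.normcM exprMn. Qed.

Lemma sqmodD_le x y (p q : R) k : 0 < p -> 0 < q ->
  sqmod (x + y) k <=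
  (((p + q) / p) *: sqmod x + ((p + q) / q) *: sqmod y) k.
Proof.
move=> p0 q0.
have -> : (((p + q) / p) *: sqmod x + ((p + q) / q) *: sqmod y) k =
  (p + q) / p * Normc.normc (x k) ^+ 2 + (p + q) / q * Normc.normc (y k) ^+ 2.
  by [].
have := @le_normcD R (x k) (y k).
rewrite /sqmod -[(x + y) k]/(x k + y k).
have := normc_ge0 (x k); have := normc_ge0 (y k).
have := normc_ge0 (x k + y k).
move: (Normc.normc (x k + y k)) (Normc.normc (x k)) (Normc.normc (y k)).
move=> c a b c0 b0 a0 cab.
have /le_trans : c ^+ 2 <= (a + b) ^+ 2 by rewrite ler_sqr ?nnegrE ?addr_ge0.
apply; rewrite -subr_ge0.
suff -> : (p + q) / p * a ^+ 2 + (p + q) / q * b ^+ 2 - (a + b) ^+ 2 =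
  (q * a - p * b) ^+ 2 / (p * q).
  by rewrite divr_ge0 ?sqr_ge0// mulr_ge0 ?ltW.
by field; rewrite !gt_eqF.
Qed.

Lemma square_summable_submod : submod_closed square_summable.
Proof.
split => [|a x y /square_summableP cx /square_summableP cy].
  apply: square_summableI; rewrite sqmod0.
  have -> : series (0 : nat -> R) = fun=> 0.
    by apply/funext => n; rewrite /series /= big1.
  exact: is_cvg_cst.
apply: square_summableI.
pose v := ((1 + 1) / 1 : R) *: sqmod (a *: x) + ((1 + 1) / 1 : R) *: sqmod y.
apply: (@series_le_cvg _ _ v).
- exact: sqmod_ge0.
- move=> n; have pos2 : 0 <= (1 + 1) / 1 :> R by rewrite divr_ge0 ?addr_ge0.
  apply: addr_ge0; apply: mulr_ge0 => //; exact: sqmod_ge0.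
- by move=> n; exact: sqmodD_le.
- apply: is_cvg_seriesD; apply: is_cvg_seriesZ => //.
  by rewrite sqmodZ; apply: is_cvg_seriesZ.
Qed.

HB.instance Definition _ :=
  GRing.isSubmodClosed.Build _ _ square_summable square_summable_submod.

End SquareSummable.

Record l2 (R : realType) : Type :=
  L2 { l2val :> nat -> R[i]; l2valP : l2val \in @square_summable R }.

HB.instance Definition _ (R : realType) := [isSub for @l2val R].
HB.instance Definition _ (R : realType) := [Choice of l2 R by <:].
HB.instance Definition _ (R : realType) :=
  [SubChoice_isSubLmodule of l2 R by <:].

Definition l2norm (R : realType) (x : l2 R) : R :=
  Num.sqrt (limn (series (sqmod x))).

Section L2Norm.
Variable R : realType.
Implicit Types (x y : l2 R) (a : R[i]).
Local Open Scope complex_scope.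

Lemma l2_cvg x : cvgn (series (sqmod x)).
Proof. exact: square_summableP (l2valP x). Qed.

Lemma l2_lim_ge0 x : 0 <= limn (series (sqmod x)).
Proof.
apply: limr_ge; first exact: l2_cvg.
by apply: nearW => n; apply: sumr_ge0 => k _; exact: sqmod_ge0.
Qed.

Lemma l2norm_ge0 x : 0 <= l2norm x. Proof. exact: sqrtr_ge0. Qed.

Lemma l2norm_sqr x : l2norm x ^+ 2 = limn (series (sqmod x)).
Proof. by rewrite sqr_sqrtr ?l2_lim_ge0. Qed.

Lemma l2norm0_eq0 x : l2norm x = 0 -> x = 0.
Proof.
move=> x0; apply/val_inj/funext => k /=.
have : sqmod x k <= 0.
  have <- : limn (series (sqmod x)) = 0 by rewrite -l2norm_sqr x0 expr0n.
  apply: (@le_trans _ _ (series (sqmod x) k.+1)).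
    rewrite seriesSr /= lerDr.
    by apply: sumr_ge0 => i _; exact: sqmod_ge0.
  apply: nondecreasing_cvgn_le; last exact: l2_cvg.
  by apply: nondecreasing_series => i _ _; exact: sqmod_ge0.
rewrite /sqmod => h; apply: Normc.eq0_normc; apply/eqP.
by rewrite -sqrf_eq0 eq_le h sqr_ge0.
Qed.

Lemma l2normZ a x : l2norm (a *: x) = Normc.normc a * l2norm x.
Proof.
rewrite /l2norm.
have -> : sqmod (a *: x) = Normc.normc a ^+ 2 *: sqmod x by exact: sqmodZ.
rewrite lim_seriesZ; last exact: l2_cvg.
by rewrite sqrtrM ?sqr_ge0// sqrtr_sqr ger0_norm ?normc_ge0.
Qed.

Lemma l2norm0 : l2norm (0 : l2 R) = 0.
Proof. by rewrite -(scale0r 0) l2normZ Normc.normc0 mul0r. Qed.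

Lemma l2normD x y : l2norm (x + y) <= l2norm x + l2norm y.
Proof.
have [x0|x0] := eqVneq (l2norm x) 0.
  by rewrite x0 (l2norm0_eq0 x0) !add0r.
have [y0|y0] := eqVneq (l2norm y) 0.
  by rewrite y0 (l2norm0_eq0 y0) !addr0.
have px : 0 < l2norm x by rewrite lt_neqAle eq_sym x0 l2norm_ge0.
have py : 0 < l2norm y by rewrite lt_neqAle eq_sym y0 l2norm_ge0.
rewrite -ler_sqr ?nnegrE ?addr_ge0 ?l2norm_ge0// l2norm_sqr.
move: (l2norm x) (l2norm y) px py (l2norm_sqr x) (l2norm_sqr y).
move=> p q p0 q0 ep eq.
have -> : (p + q) ^+ 2 = (p + q) / p * p ^+ 2 + (p + q) / q * q ^+ 2.
  by field; rewrite !gt_eqF.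
rewrite ep eq -[_ / p * _]/(_ / p *: _) -[_ / q * _]/(_ / q *: _).
rewrite -!lim_seriesZ; [|exact: l2_cvg..].
rewrite -lim_seriesD; [|by apply: is_cvg_seriesZ; exact: l2_cvg..].
apply: lim_series_le; first exact: l2_cvg.
  by apply: is_cvg_seriesD; apply: is_cvg_seriesZ; exact: l2_cvg.
by move=> n; exact: sqmodD_le.
Qed.

Lemma l2norm_triangle x y :
  (l2norm (x + y))%:C <= (l2norm x)%:C + (l2norm y)%:C.
Proof. by rewrite -rmorphD lecR l2normD. Qed.

Lemma l2norm_homog a x : (l2norm (a *: x))%:C = `|a| * (l2norm x)%:C.
Proof. by rewrite l2normZ rmorphM. Qed.

Lemma l2norm_definite x : (l2norm x)%:C = 0 -> x = 0.
Proof. by case=> /l2norm0_eq0. Qed.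

HB.instance Definition _ := Lmodule_isNormed.Build R[i] (l2 R)
  l2norm_triangle l2norm_homog l2norm_definite.

Lemma l2_normE x : `|x| = (l2norm x)%:C.
Proof. by []. Qed.

End L2Norm.

Section InnerProduct.
Variable R : realType.
Implicit Types (x y : l2 R).
Local Open Scope complex_scope.

Definition dot x y : R[i] :=
  limn (series (fun k => x k * (y k)^*%C : R[i]^o)).

Lemma normc_le_ReIm (z : R[i]) :
  Normc.normc z <= `|complex.Re z| + `|complex.Im z|.
Proof.
case: z => a b /=; rewrite -[leRHS]ger0_norm ?addr_ge0// -sqrtr_sqr.
rewrite ler_wsqrtr// sqrrD !real_normK ?num_real// addrAC lerDl.
by rewrite mulrn_wge0 ?mulr_ge0.
Qed.

Lemma cvg_complex (u : nat -> R[i]) (a b : R) :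
  (fun n => complex.Re (u n)) @ \oo --> a -> (fun n => complex.Im (u n)) @ \oo --> b ->
  u @ \oo --> (a +i* b : R[i]^o).
Proof.
move=> ca cb; apply/(@cvgrPdist_lt _ R[i]^o) => -[e e'] /=.
rewrite ltcE /= => /andP[/eqP -> e0].
have e2 : 0 < e / 2 by rewrite divr_gt0.
near=> n; rewrite /Num.norm /= -/(Normc.normc _) ltcR.
apply: (le_lt_trans (normc_le_ReIm _)).
rewrite (splitr e); apply: ltrD.
  have : `|a - complex.Re (u n)| < e / 2.
    by near: n; exact: ((@cvgrPdist_lt _ R _ _ _ _ _).1 ca _ e2).
  by rewrite /=; case: (u n).
have : `|b - complex.Im (u n)| < e / 2.
  by near: n; exact: ((@cvgrPdist_lt _ R _ _ _ _ _).1 cb _ e2).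
by rewrite /=; case: (u n).
Unshelve. all: by end_near. Qed.

Lemma series_Re (u : nat -> R[i]) n :
  complex.Re (series u n) = series (fun k => complex.Re (u k)) n.
Proof. by rewrite /series /= raddf_sum. Qed.

Lemma series_Im (u : nat -> R[i]) n :
  complex.Im (series u n) = series (fun k => complex.Im (u k)) n.
Proof. by rewrite /series /= raddf_sum. Qed.

Lemma cvg_dot_part (f : nat -> R) x y :
  (forall k, `|f k| <= Normc.normc (x k * (y k)^*%C)) -> cvgn (series f).
Proof.
move=> fxy; apply: normed_cvg.
apply: (@series_le_cvg _ _ (sqmod x + sqmod y)).
- by move=> n; exact: normr_ge0.
- by move=> n; rewrite -[X in _ <= X]/(sqmod x n + sqmod y n) addr_ge0 ?sqmod_ge0.
- move=> n; apply: (le_trans (fxy n)); rewrite Normc.normcM.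
  have -> : Normc.normc (y n)^*%C = Normc.normc (y n).
    by case: (y n) => a b /=; rewrite sqrrN.
  rewrite -[leRHS]/(Normc.normc (x n) ^+ 2 + Normc.normc (y n) ^+ 2).
  have := normc_ge0 (x n); have := normc_ge0 (y n).
  have := sqr_ge0 (Normc.normc (x n) - Normc.normc (y n)).
  nra.
- by apply: is_cvg_seriesD; exact: l2_cvg.
Qed.

Lemma dotP x y :
  series (fun k => x k * (y k)^*%C) @ \oo --> (dot x y : R[i]^o).
Proof.
pose u k := x k * (y k)^*%C.
have cr : cvgn (series (fun k => complex.Re (u k))).
  apply: (@cvg_dot_part _ x y) => k; rewrite -/(u k).
  case: (u k) => a b /=; rewrite -sqrtr_sqr ler_wsqrtr//.
  by rewrite lerDl sqr_ge0.
have ci : cvgn (series (fun k => complex.Im (u k))).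
  apply: (@cvg_dot_part _ x y) => k; rewrite -/(u k).
  case: (u k) => a b /=; rewrite -sqrtr_sqr ler_wsqrtr//.
  by rewrite lerDr sqr_ge0.
suff : cvgn (series (u : nat -> R[i]^o)) by [].
apply/cvg_ex; exists (limn (series (fun k => complex.Re (u k))) +i*
  limn (series (fun k => complex.Im (u k)))).
apply: cvg_complex; first by under eq_fun do rewrite series_Re.
by under eq_fun do rewrite series_Im.
Qed.

Lemma dotxx x : dot x x = (l2norm x ^+ 2)%:C.
Proof.
rewrite l2norm_sqr; apply: (@cvg_lim R[i]^o) => //.
apply: cvg_complex.
  under eq_fun do rewrite series_Re.
  rewrite (_ : (fun _ => _) = series (sqmod x)); first exact: l2_cvg.
  apply/funext => n; congr (series _ n); apply/funext => k.
  rewrite /sqmod; case: (x k) => a b /=.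
  by rewrite sqr_sqrtr ?addr_ge0 ?sqr_ge0//; ring.
under eq_fun do rewrite series_Im.
rewrite (_ : (fun _ => _) = fun=> 0); first exact: cvg_cst.
apply/funext => n; rewrite /series /= big1// => k _.
by case: (x k) => a b /=; ring.
Qed.

End InnerProduct.

Section Basis.
Variable R : realType.

Lemma delta_summable (j : nat) :
  (fun k => (k == j)%:R : R[i]) \in @square_summable R.
Proof.
apply: square_summableI; apply/cvg_ex.
exists (series (sqmod (fun k => (k == j)%:R : R[i])) j.+1).
apply: cvg_near_cst.
near=> n; have jn : (j.+1 <= n)%N by near: n; exact: nbhs_infty_ge.
apply/eqP; rewrite -subr_eq0 sub_series_geq// big_nat big1// => k /andP[jk _].
by rewrite /sqmod gtn_eqF// Normc.normc0 expr0n.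
Unshelve. all: by end_near. Qed.

Definition ebasis (j : nat) : l2 R := L2 (delta_summable j).

End Basis.

Arguments ebasis {R} j.

Section Operators.
Variable R : realType.
Implicit Types (T U A P Q : l2 R -> l2 R) (V W : set (l2 R)).

Definition bounded_operator T : Prop :=
  linear T /\ exists C : R, forall x, l2norm (T x) <= C * l2norm x.

Definition invertible_operator T : Prop :=
  exists S, [/\ bounded_operator S, S \o T = id & T \o S = id].

Definition is_adjoint T A : Prop := forall x y, dot (T x) y = dot x (A y).

(* Every bounded operator has exactly one adjoint, so the choice made by [get]
   is immaterial. *)
Definition adjoint T : l2 R -> l2 R := get (is_adjoint T).

Definition unitary_operator U : Prop :=
  bounded_operator U /\
  exists A, [/\ is_adjoint U A, A \o U = id & U \o A = id].

Definition orthogonal_projection P : Prop :=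
  [/\ bounded_operator P, P \o P = P & is_adjoint P P].

Definition invariant_subspace T V : Prop := forall x, V x -> V (T x).

Definition matrix_entry T (i j : nat) : R[i] := dot (T (ebasis j)) (ebasis i).

Definition upper_triangular T : Prop :=
  forall i j, (j < i)%N -> matrix_entry T i j = 0.

Definition finite_columns T : Prop :=
  forall j, finite_set [set i | matrix_entry T i j != 0].

(* The factors Q^(m) and R^(m) are indexed from m = 1, so the values of [Qf]
   and [Rf] at 0 play no role; Q_0 = R_0 = id is the empty product. *)
Definition QR_sequences T (Q_ R_ : nat -> l2 R -> l2 R) : Prop :=
  exists T_ Qf Rf : nat -> l2 R -> l2 R,
    [/\ T_ 0%N = T,
        forall m, [/\ unitary_operator (Qf m.+1),
                      bounded_operator (Rf m.+1),
                      upper_triangular (Rf m.+1),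
                      T_ m = Qf m.+1 \o Rf m.+1 &
                      T_ m.+1 = Rf m.+1 \o Qf m.+1],
        Q_ 0%N = id /\ (forall n, Q_ n.+1 = Q_ n \o Qf n.+1) &
        R_ 0%N = id /\ (forall n, R_ n.+1 = Rf n.+1 \o R_ n)].

End Operators.

Section Subspaces.
Variable R : realType.
Implicit Types (J : set nat) (v : nat -> l2 R) (V W : set (l2 R)).

(* A cardinality M in {0, 1, 2, ..., oo}, with [None] standing for oo; the
   indices j = 1, ..., M are shifted to j = 0, ..., M - 1. *)
Definition below (M : option nat) : set nat :=
  if M is Some m then `I_m else setT.

Definition lspan J v : set (l2 R) :=
  [set x | exists n (c : nat -> R[i]),
             x = \sum_(j < n | (j : nat) \in J) c j *: v j].

Definition lin_indep J v : Prop :=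
  forall n (c : nat -> R[i]), \sum_(j < n | (j : nat) \in J) c j *: v j = 0 ->
  forall j, (j < n)%N -> J j -> c j = 0.

Definition has_dim V (M : option nat) : Prop :=
  match M with
  | Some m => exists2 v, lin_indep `I_m v & lspan `I_m v = V
  | None => forall m, exists2 v, lin_indep `I_m v & lspan `I_m v `<=` V
  end.

Definition subspace_delta V W : R :=
  sup [set inf [set l2norm (x - y) | y in W]
        | x in [set x | V x /\ l2norm x = 1]].

Definition subspace_gap V W : R := Num.max (subspace_delta V W) (subspace_delta W V).

End Subspaces.

Section Limits.
Variable R : realType.
Implicit Types (A : l2 R -> l2 R) (As : nat -> l2 R -> l2 R).
Implicit Types (J : set nat) (V W : set (l2 R)).

Definition sot_cvg As A : Prop := forall x, (fun k => As k x) @ \oo --> A x.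

Definition wot_cvg As A : Prop :=
  forall x y, (fun k => dot (As k x) y) @ \oo --> (dot (A x) y : R[i]^o).

Definition tensor (u v : l2 R) : l2 R -> l2 R := fun x => dot x v *: u.

(* A is the strong sum of the u_j (x) v_j over j in J, in increasing order. *)
Definition tensor_sum J (u v : nat -> l2 R) A : Prop :=
  bounded_operator A /\
  sot_cvg (fun n x => \sum_(j < n | (j : nat) \in J) tensor (u j) (v j) x) A.

Definition operator_direct_sum V W (A1 A2 A : l2 R -> l2 R) : Prop :=
  [/\ invariant_subspace A1 V, invariant_subspace A2 W &
      forall v w, V v -> W w -> A (v + w) = A1 v + A2 w].

Definition subseq_cvg (cvg_op : (nat -> l2 R -> l2 R) -> (l2 R -> l2 R) -> Prop)
    (T : l2 R -> l2 R) (Q_ : nat -> l2 R -> l2 R) (M : option nat)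
    (ehat : nat -> l2 R) : Prop :=
  let Theta := [set i | ~ (ehat @` below M) (ebasis i)] in
  let V := closure (lspan (below M) ehat) in
  let W := closure (lspan Theta ebasis) in
  forall phi : nat -> nat, {homo phi : m n / (m < n)%N} ->
  exists psi : nat -> nat, {homo psi : m n / (m < n)%N} /\
  exists (xi zeta : nat -> l2 R) (A1 A2 A : l2 R -> l2 R),
    [/\ forall j, below M j -> V (xi j),
        forall i, Theta i -> W (zeta i),
        tensor_sum (below M) xi ehat A1 /\ tensor_sum Theta zeta ebasis A2,
        bounded_operator A /\ operator_direct_sum V W A1 A2 A &
        cvg_op (fun k => let n := phi (psi k) in adjoint (Q_ n) \o T \o Q_ n) A].

End Limits.

(* Main.v *)
(* Call [i] a pivot when [P e_i] is not in the span of the [P e_k] with [k < i];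
   the [hat e_j] enumerate the [e_i] with [i] a pivot.

   Since the [R]-sequence is upper triangular and injective,
   [Q_n span(e_0, ..., e_{m-1}) = T^n span(e_0, ..., e_{m-1})] for all [m]. On a
   fixed finite-dimensional space meeting [ker P] trivially, [T^n] contracts the
   component in [ker P] by [(beta/alpha)^n] relatively to the component in the
   range of [P]. Hence [Q_n e_i] is [O((beta/alpha)^n)]-close to the range of [P]
   if [i] is a pivot. If [i] is not a pivot, a dimension count shows that for
   large [n] the projection [P Q_n e_i] is [P v] for a [v] in the span of the
   [Q_n e_k] with [k < i] a pivot; as [v] is orthogonal to [Q_n e_i] and close to
   the range of [P], [P Q_n e_i] tends to [0].

   So the entries of [Q_n^* T Q_n] between pivots and non-pivots tend to [0], and
   (ii) follows from the weak compactness of bounded sets of operators. When the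
   columns of [T] are finite, the [j]-th columns of all the [Q_n^* T Q_n] lie in a
   common finite-dimensional space, where weak and strong convergence agree. *)

Require Import Defs.
From mathcomp Require Import all_boot all_order all_algebra.
From mathcomp Require Import all_classical all_reals all_analysis.
From mathcomp Require Import complex ring lra.
Import Order.TTheory GRing.Theory Num.Theory numFieldNormedType.Exports.

Set Implicit Arguments.
Unset Strict Implicit.
Unset Printing Implicit Defensive.

Local Open Scope classical_set_scope.
Local Open Scope ring_scope.

Arguments l2val : simpl never.

(** * Complex sequences and the inner product of l2 *)

Section RealSequences.
Variable R : realType.
Implicit Types f g : nat -> R.

Lemma squeeze0 f g : (\forall n \near \oo, 0 <= f n <= g n) ->
  g n @[n --> \oo] --> 0 -> f n @[n --> \oo] --> 0.
Proof.
move=> fg g0; apply: (squeeze_cvgr fg) => //; exact: cvg_cst.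
Qed.

Lemma cvg0Mr f (c : R) : f n @[n --> \oo] --> 0 -> f n * c @[n --> \oo] --> 0.
Proof.
by move=> f0; have := @cvgMr_tmp _ _ _ _ f 0 c f0; rewrite mul0r; exact.
Qed.

Lemma cvg0D f g : f n @[n --> \oo] --> 0 -> g n @[n --> \oo] --> 0 ->
  f n + g n @[n --> \oo] --> 0.
Proof.
by move=> f0 g0; have := @cvgD _ _ _ _ _ f g _ _ f0 g0; rewrite addr0; exact.
Qed.

Lemma cvg0_sum (I : Type) (s : seq I) (p : pred I) (h : I -> nat -> R) :
  (forall i, p i -> h i n @[n --> \oo] --> 0) ->
  \sum_(i <- s | p i) h i n @[n --> \oo] --> 0.
Proof.
move=> h0; elim: s => [|i s IH].
  have -> : (fun n => \sum_(i <- [::] | p i) h i n) = fun=> 0.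
    by apply/funext => n; rewrite big_nil.
  exact: cvg_cst.
have -> : (fun n => \sum_(j <- i :: s | p j) h j n) =
    fun n => (if p i then h i n else 0) + \sum_(j <- s | p j) h j n.
  by apply/funext => n; rewrite big_cons; case: ifP; rewrite ?add0r.
apply: cvg0D => //; case: (p i) (h0 i) => [|_]; [exact|exact: cvg_cst].
Qed.

End RealSequences.

Section Complex.
Variable R : realType.
Implicit Types (z w : R[i]).
Local Notation normc := (@Normc.normc R).

Lemma normc_conj z : normc z^*%C = normc z.
Proof. by case: z => a b /=; rewrite sqrrN. Qed.

Lemma normcB z w : normc (z - w) = normc (w - z).
Proof. by rewrite -normcN opprB. Qed.

Lemma normc_real (a : R) : normc a%:C%C = `|a|.
Proof. by rewrite /= expr0n addr0 sqrtr_sqr. Qed.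

Lemma mul_conjc z : z * z^*%C = (normc z ^+ 2)%:C%C.
Proof. by rewrite -sqr_normc rmorphXn. Qed.

Lemma normc_ler_Re z : `|complex.Re z| <= normc z.
Proof. by case: z => a b /=; rewrite -sqrtr_sqr ler_wsqrtr// lerDl sqr_ge0. Qed.

Lemma normc_ler_Im z : `|complex.Im z| <= normc z.
Proof. by case: z => a b /=; rewrite -sqrtr_sqr ler_wsqrtr// lerDr sqr_ge0. Qed.

Lemma normc_sum (I : Type) (s : seq I) (p : pred I) (f : I -> R[i]) :
  normc (\sum_(i <- s | p i) f i) <= \sum_(i <- s | p i) normc (f i).
Proof.
elim/big_rec2: _ => [|i b a _ ab]; first by rewrite Normc.normc0.
by apply: (le_trans (le_normcD _ _)); rewrite lerD2l.
Qed.

(** The norm of [R[i]] takes values in [R[i]] itself, where a positive element has zero imaginary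
    part; real radii therefore suffice. *)
Lemma complex_cvgP (u : nat -> R[i]) (l : R[i]) :
  u @ \oo --> (l : R[i]^o) <->
  (forall e : R, 0 < e -> \forall n \near \oo, normc (l - u n) < e).
Proof.
split=> [/(@cvgrPdist_lt _ R[i]^o) h e e0|h].
  have /h : 0 < e%:C%C by rewrite ltcR.
  apply: filterS => n.
  by rewrite /Num.norm /= -/(Normc.normc _) ltcR.
apply/(@cvgrPdist_lt _ R[i]^o) => -[e e'].
rewrite ltcE /= => /andP[/eqP -> e0].
have := h e e0; apply: filterS => n.
by rewrite /Num.norm /= -/(Normc.normc _) ltcR.
Qed.

Lemma complex_cvg0P (u : nat -> R[i]) (l : R[i]) :
  u @ \oo --> (l : R[i]^o) <-> normc (l - u n) @[n --> \oo] --> (0 : R).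
Proof.
rewrite complex_cvgP; split=> [h|/(@cvgrPdist_lt _ R^o) h e e0].
  apply/(@cvgrPdist_lt _ R^o) => e /h; apply: filterS => n.
  by rewrite sub0r normrN ger0_norm ?normc_ge0.
have := h e e0; apply: filterS => n.
by rewrite sub0r normrN ger0_norm ?normc_ge0.
Qed.

Lemma complex_cvg_conj (u : nat -> R[i]) (l : R[i]) :
  u @ \oo --> (l : R[i]^o) -> (fun n => (u n)^*%C) @ \oo --> (l^*%C : R[i]^o).
Proof.
move=> /complex_cvgP h; apply/complex_cvgP => e /h; apply: filterS => n.
by rewrite -rmorphB normc_conj.
Qed.

End Complex.

Section Dot.
Variable R : realType.
Implicit Types (x y z : l2 R) (a : R[i]).
Local Notation normc := (@Normc.normc R).

Lemma dot_linear a x y z : dot (a *: x + y) z = a * dot x z + dot y z.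
Proof.
apply: (@cvg_lim R[i]^o) => //.
have -> : series (fun k => (a *: x + y) k * (z k)^*%C : R[i]^o) =
  (fun n => a *: (series (fun k => x k * (z k)^*%C) n : R[i]^o) +
            series (fun k => y k * (z k)^*%C) n).
  apply/funext => n; rewrite /series /= scaler_sumr -big_split /=.
  by apply: eq_bigr => k _; rewrite -/(a * x k + y k) mulrDl -mulrA.
by apply: cvgD; [apply: cvgZl_tmp|]; exact: dotP.
Qed.

Lemma dotC x y : dot y x = (dot x y)^*%C.
Proof.
apply: (@cvg_lim R[i]^o) => //.
have := complex_cvg_conj (@dotP R x y).
rewrite (_ : (fun n => _) = series (fun k => y k * (x k)^*%C))//.
apply/funext => n; rewrite /series /= rmorph_sum/=; apply: eq_bigr => k _.
by rewrite rmorphM /= conjcK mulrC.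
Qed.

Lemma dotDl x y z : dot (x + y) z = dot x z + dot y z.
Proof. by rewrite -{1}[x]scale1r dot_linear mul1r. Qed.

Lemma dot0l z : dot 0 z = 0.
Proof. by apply: (addrI (dot 0 z)); rewrite -dotDl !addr0. Qed.

Lemma dotZl a x z : dot (a *: x) z = a * dot x z.
Proof. by rewrite -[a *: x]addr0 dot_linear dot0l addr0. Qed.

Lemma dotNl x z : dot (- x) z = - dot x z.
Proof. by rewrite -scaleN1r dotZl mulN1r. Qed.

Lemma dotBl x y z : dot (x - y) z = dot x z - dot y z.
Proof. by rewrite dotDl dotNl. Qed.

Lemma dotDr x y z : dot x (y + z) = dot x y + dot x z.
Proof. by rewrite dotC dotDl rmorphD /= -!dotC. Qed.

Lemma dotZr a x z : dot x (a *: z) = a^*%C * dot x z.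
Proof. by rewrite dotC dotZl rmorphM /= -dotC. Qed.

Lemma dot0r x : dot x 0 = 0.
Proof. by rewrite dotC dot0l rmorph0. Qed.

Lemma dotBr x y z : dot x (y - z) = dot x y - dot x z.
Proof. by rewrite dotC dotBl rmorphB /= -!dotC. Qed.

Lemma dot_suml (I : Type) (s : seq I) (p : pred I) (f : I -> l2 R) z :
  dot (\sum_(i <- s | p i) f i) z = \sum_(i <- s | p i) dot (f i) z.
Proof.
by elim/big_rec2: _ => [|i a b _ <-]; rewrite ?dot0l ?dotDl.
Qed.

Lemma dot_sumr (I : Type) (s : seq I) (p : pred I) (f : I -> l2 R) z :
  dot z (\sum_(i <- s | p i) f i) = \sum_(i <- s | p i) dot z (f i).
Proof.
by elim/big_rec2: _ => [|i a b _ <-]; rewrite ?dot0r ?dotDr.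
Qed.

Lemma l2normN x : l2norm (- x) = l2norm x.
Proof. by rewrite -scaleN1r l2normZ normcN Normc.normc1 mul1r. Qed.

Lemma l2normB x y : l2norm (x - y) = l2norm (y - x).
Proof. by rewrite -l2normN opprB. Qed.

Lemma l2normB_le x y : l2norm x - l2norm y <= l2norm (x - y).
Proof. by rewrite lerBlDr (le_trans _ (l2normD _ _))// subrK. Qed.

Lemma l2norm_sum (I : Type) (s : seq I) (p : pred I) (f : I -> l2 R) :
  l2norm (\sum_(i <- s | p i) f i) <= \sum_(i <- s | p i) l2norm (f i).
Proof.
elim/big_rec2: _ => [|i b a _ ab]; first by rewrite l2norm0.
by apply: (le_trans (l2normD _ _)); rewrite lerD2l.
Qed.

Lemma l2norm_gt0 x : (0 < l2norm x) = (x != 0).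
Proof.
rewrite lt_neqAle l2norm_ge0 andbT eq_sym; congr (~~ _).
by apply/eqP/eqP => [/l2norm0_eq0|->]; rewrite ?l2norm0.
Qed.

Lemma dotxx_eq0 x : dot x x = 0 -> x = 0.
Proof.
rewrite dotxx => -[/eqP]; rewrite sqrf_eq0 => /eqP; exact: l2norm0_eq0.
Qed.

(* With [c = <x, y>], [0 <= |(|y|^2) x - c y|^2 = |y|^2 (|x|^2 |y|^2 - |c|^2)]. *)
Lemma cauchy_schwarz x y : normc (dot x y) <= l2norm x * l2norm y.
Proof.
have [->|y0] := eqVneq y 0; first by rewrite dot0r Normc.normc0 l2norm0 mulr0.
have ny : 0 < l2norm y by rewrite l2norm_gt0.
(* The real scalar [|y|^2] is made an opaque self-conjugate [t], so that conjugates simplify and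
   [ring] sees an atom. *)
have [t tJ tE] : exists2 t : R[i], t^*%C = t & (l2norm y ^+ 2)%:C%C = t.
  by exists (l2norm y ^+ 2)%:C%C => //; exact: conjc_real.
have : dot (t *: x - dot x y *: y) (t *: x - dot x y *: y) =
  (l2norm y ^+ 2 * (l2norm x ^+ 2 * l2norm y ^+ 2 - normc (dot x y) ^+ 2))%:C%C.
  rewrite !dotBl !dotBr !dotZl !dotZr tJ !dotxx (dotC x y).
  have CM (b c d : R) : (b * (c * b - d))%:C%C =
    b%:C%C * (c%:C%C * b%:C%C - d%:C%C) by rewrite -!(rmorphM, rmorphB).
  by rewrite CM tE -mul_conjc; ring.
rewrite dotxx => /complexI h.
rewrite -ler_sqr ?nnegrE ?mulr_ge0 ?l2norm_ge0 ?normc_ge0// exprMn -subr_ge0.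
have := sqr_ge0 (l2norm (t *: x - dot x y *: y)).
by rewrite h pmulr_rge0// exprn_gt0.
Qed.

Lemma ebasisE i k : ebasis i k = (k == i)%:R :> R[i]. Proof. by []. Qed.

Lemma dot_ebasis x i : dot x (ebasis i) = x i.
Proof.
apply: (@cvg_lim R[i]^o) => //; apply/complex_cvgP => e e0.
exists i.+1 => // n /= ni; suff -> : x i - series (fun k => x k * (ebasis i k)^*%C) n = 0.
  by rewrite Normc.normc0.
apply/eqP; rewrite subr_eq0; apply/eqP/esym; rewrite /series /=.
rewrite (bigD1_seq i) ?iota_uniq//=; last by rewrite mem_index_iota.
rewrite ebasisE eqxx conjc1 mulr1 big1 ?addr0// => k /negbTE ki.
by rewrite ebasisE ki conjc0 mulr0.
Qed.

Lemma l2P x y : (forall i, x i = y i) -> x = y.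
Proof. by move=> h; apply/val_inj/funext. Qed.

Lemma l2D x y i : (x + y) i = x i + y i. Proof. by []. Qed.
Lemma l2B x y i : (x - y) i = x i - y i. Proof. by []. Qed.
Lemma l2Z a x i : (a *: x) i = a * x i. Proof. by []. Qed.
Lemma l20 i : (0 : l2 R) i = 0. Proof. by []. Qed.

Lemma l2sum (I : Type) (s : seq I) (p : pred I) (f : I -> l2 R) k :
  (\sum_(i <- s | p i) f i) k = \sum_(i <- s | p i) f i k.
Proof. by rewrite -dot_ebasis dot_suml; apply: eq_bigr => i _; rewrite dot_ebasis. Qed.

Lemma l2norm_ebasis i : l2norm (ebasis i : l2 R) = 1.
Proof.
have := dotxx (ebasis i : l2 R); rewrite dot_ebasis ebasisE eqxx => -[h].
by apply/eqP; rewrite -sqrp_eq1 ?l2norm_ge0// -h.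
Qed.

Lemma normc_coord x i : normc (x i) <= l2norm x.
Proof.
by rewrite -dot_ebasis (le_trans (cauchy_schwarz _ _))// l2norm_ebasis mulr1.
Qed.

Lemma ebasis_inj : injective (@ebasis R).
Proof.
move=> i j /(congr1 (fun x : l2 R => x i)); rewrite !ebasisE eqxx.
by case: eqP => // _ /eqP; rewrite oner_eq0.
Qed.

Lemma l2_cvgP (u : nat -> l2 R) x :
  u @ \oo --> x <-> l2norm (x - u n) @[n --> \oo] --> (0 : R).
Proof.
split=> [/(@cvgrPdist_lt _ (l2 R)) h|/(@cvgrPdist_lt _ R^o) h].
  apply/(@cvgrPdist_lt _ R^o) => e e0.
  have /h : 0 < e%:C%C by rewrite ltcR.
  apply: filterS => n.
  by rewrite l2_normE ltcR sub0r normrN ger0_norm ?l2norm_ge0.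
apply/(@cvgrPdist_lt _ (l2 R)) => -[e e'].
rewrite ltcE /= => /andP[/eqP -> e0].
have := h e e0; apply: filterS => n.
by rewrite l2_normE ltcR sub0r normrN ger0_norm ?l2norm_ge0.
Qed.

End Dot.

(** * Coordinate subspaces of l2 *)

Section Restriction.
Variable R : realType.
Implicit Types (x y z : l2 R) (a : R[i]) (D J : set nat).
Local Notation normc := (@Normc.normc R).

Lemma square_summable_le (f : nat -> R[i]) x :
  (forall k, normc (f k) <= normc (x k)) -> f \in @square_summable R.
Proof.
move=> fx; apply: square_summableI; apply: (@series_le_cvg _ _ (sqmod x)).
- exact: sqmod_ge0.
- exact: sqmod_ge0.
- by move=> n; rewrite /sqmod ler_sqr ?nnegrE ?normc_ge0.
- exact: l2_cvg.
Qed.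

Lemma l2norm_le_coord x y :
  (forall k, normc (x k) <= normc (y k)) -> l2norm x <= l2norm y.
Proof.
move=> xy; apply: ler_wsqrtr; apply: lim_series_le; [exact: l2_cvg..|].
by move=> n; rewrite /sqmod ler_sqr ?nnegrE ?normc_ge0.
Qed.

(** Nondecreasing bounded partial sums converge. Weak limits are assembled from their coordinates in
    this way. *)
Lemma l2_of_bounded_partial_sums (f : nat -> R[i]) (C : R) : 0 <= C ->
  (forall n, \sum_(k < n) normc (f k) ^+ 2 <= C ^+ 2) ->
  exists2 x : l2 R, (forall k, x k = f k) & l2norm x <= C.
Proof.
move=> C0 fC.
have fC' n : series (sqmod f) n <= C ^+ 2.
  by rewrite /series /= big_mkord; exact: fC.
have cf : cvgn (series (sqmod f)).
  apply: nondecreasing_is_cvgn.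
    by apply: nondecreasing_series => i _ _; exact: sqmod_ge0.
  by exists (C ^+ 2) => _ [n _ <-].
exists (L2 (square_summableI cf)) => //.
rewrite -ler_sqr ?nnegrE ?l2norm_ge0// l2norm_sqr.
by apply: limr_le => //; exact: nearW.
Qed.

Lemma restr_summable D x :
  (fun k => if k \in D then x k else 0) \in @square_summable R.
Proof.
apply: (@square_summable_le _ x) => k.
by case: ifP => // _; rewrite Normc.normc0 normc_ge0.
Qed.

Definition restr D x : l2 R := L2 (restr_summable D x).

Lemma restrE D x k : restr D x k = if k \in D then x k else 0.
Proof. by []. Qed.

Lemma l2norm_restr D x : l2norm (restr D x) <= l2norm x.
Proof.
apply: l2norm_le_coord => k; rewrite restrE.
by case: ifP => // _; rewrite Normc.normc0 normc_ge0.
Qed.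

Lemma restr_linear D : linear (restr D).
Proof.
move=> a x y; apply: l2P => k; rewrite l2D l2Z !restrE l2D l2Z.
by case: ifP => // _; rewrite mulr0 addr0.
Qed.

Lemma restr_bounded D : bounded_operator (restr D).
Proof.
split; first exact: restr_linear.
by exists 1 => x; rewrite mul1r l2norm_restr.
Qed.

Lemma l2norm_tail_sqr x n :
  l2norm (restr (~` `I_n) x) ^+ 2 = l2norm x ^+ 2 - series (sqmod x) n.
Proof.
rewrite !l2norm_sqr; apply: (@cvg_lim R^o) => //.
have : series (sqmod x) m - series (sqmod x) n @[m --> \oo] -->
    limn (series (sqmod x)) - series (sqmod x) n.
  by apply: cvgB; [exact: l2_cvg|exact: cvg_cst].
apply: cvg_trans; apply: near_eq_cvg.
exists n => // m /= nm; rewrite sub_series_geq// /series /=.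
rewrite [RHS](@big_cat_nat _ _ _ n 0 m)//= [X in _ = X + _]big1_seq => [|k].
  rewrite add0r; apply: eq_big_nat => k /andP[nk _].
  by rewrite /sqmod restrE mem_set//= => kn; rewrite ltnNge nk in kn.
rewrite mem_index_iota => /andP[_ kn].
rewrite /sqmod restrE memNset ?Normc.normc0 ?expr0n//.
Qed.

Lemma tail_cvg0 x : l2norm (restr (~` `I_n) x) @[n --> \oo] --> (0 : R).
Proof.
apply/(@cvgrPdist_lt _ R^o) => e e0.
have e2 : 0 < e ^+ 2 by rewrite exprn_gt0.
have /(@cvgrPdist_lt _ R^o)/(_ _ e2) := @l2_cvg R x.
apply: filterS => n; rewrite -l2norm_sqr -l2norm_tail_sqr.
rewrite ger0_norm ?sqr_ge0// ltr_sqr ?nnegrE ?l2norm_ge0 ?ltW// => h.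
by rewrite sub0r normrN ger0_norm ?l2norm_ge0.
Qed.

Lemma restr_partial_sum J (p : nat -> nat) x n : set_inj J p ->
  restr (p @` (J `&` `I_n)) x =
  \sum_(j < n | (j : nat) \in J) x (p j) *: ebasis (p j).
Proof.
move=> pinj; apply: l2P => k; rewrite restrE l2sum.
case: ifPn => [|/negP kJ].
  rewrite inE => -[j [Jj /= jn] <-].
  rewrite (bigD1 (Ordinal jn)) ?mem_set//= l2Z ebasisE eqxx mulr1.
  rewrite big1 ?addr0// => i /andP[Ji ij]; rewrite l2Z ebasisE.
  case: eqP => [pij|]; rewrite ?mulr0//.
  case/negP: ij; apply/eqP/val_inj/esym/pinj => //; exact: mem_set.
rewrite big1// => i Ji; rewrite l2Z ebasisE.
case: eqP => [pik|]; rewrite ?mulr0//.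
case: kJ; rewrite inE; exists i => //; split; first exact: set_mem.
exact: ltn_ord.
Qed.

(** The enumeration [p] need not be increasing. Still, the image indices below any [N] are exhausted
    after finitely many terms, and from then on the error is dominated by the tail of [x] beyond
    [N]. *)
Lemma restr_partial_sum_cvg J (p : nat -> nat) x : set_inj J p ->
  l2norm (restr (p @` J) x -
    \sum_(j < n | (j : nat) \in J) x (p j) *: ebasis (p j)) @[n --> \oo] --> (0 : R).
Proof.
move=> pinj.
have big N : exists n, p @` J `&` `I_N `<=` p @` (J `&` `I_n).
  elim: N => [|N [n IH]]; first by exists 0%N => ? [].
  have [[j Jj pj]|nJ] := pselect ((p @` J) N).
    exists (maxn n j.+1) => k [kJ /=]; rewrite ltnS leq_eqVlt => /orP[/eqP ->|kN].
      by exists j => //; split => //=; rewrite leq_max ltnSn orbT.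
    have [i [Ji /= ni] <-] := IH k (conj kJ kN).
    by exists i => //; split => //=; rewrite leq_max ni.
  exists n => k [kJ /=]; rewrite ltnS leq_eqVlt => /orP[/eqP kN|kN].
    by rewrite kN in kJ.
  exact: IH.
apply/(@cvgrPdist_lt _ R^o) => e e0.
have /(@cvgrPdist_lt _ R^o)/(_ _ e0)[N _ /(_ N (leqnn _))] := tail_cvg0 x.
rewrite !sub0r !normrN ger0_norm ?l2norm_ge0// => hN.
have [n0 hn0] := big N.
exists n0 => // n /= n0n.
rewrite sub0r normrN ger0_norm ?l2norm_ge0//; apply: le_lt_trans hN.
rewrite -restr_partial_sum//; apply: l2norm_le_coord => k.
rewrite l2B !restrE; case: ifPn => [kJ|kJ].
  case: ifPn => [_|/negP kJ']; first by rewrite subrr Normc.normc0 normc_ge0.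
  rewrite subr0 mem_set// => kN; case: kJ'; rewrite inE.
  have [j [Jj /= jn] <-] := hn0 k (conj (set_mem kJ) kN).
  by exists j => //; split => //=; exact: leq_trans n0n.
rewrite memNset ?subr0 ?Normc.normc0 ?normc_ge0//.
by move=> [j [Jj _] jk]; move/negP: kJ; apply; rewrite inE; exists j.
Qed.

(** For an initial segment [D] of length [m] this is the span of the first [m] basis vectors; in
    general it is the closed span of the [ebasis i] with [i] in [D]. *)
Definition supp D : set (l2 R) := [set x | forall i, ~ D i -> x i = 0].

Lemma suppD D x y : supp D x -> supp D y -> supp D (x + y).
Proof. by move=> hx hy i Di; rewrite l2D hx// hy// addr0. Qed.

Lemma suppZ D a x : supp D x -> supp D (a *: x).
Proof. by move=> hx i Di; rewrite l2Z hx// mulr0. Qed.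

Lemma suppB D x y : supp D x -> supp D y -> supp D (x - y).
Proof. by move=> hx hy i Di; rewrite l2B hx// hy// subr0. Qed.

Lemma supp_sum D (I : Type) (s : seq I) (p : pred I) (f : I -> l2 R) :
  (forall i, p i -> supp D (f i)) -> supp D (\sum_(i <- s | p i) f i).
Proof.
by move=> h; elim/big_rec: _ => // i x pi hx; apply: suppD => //; exact: h.
Qed.

Lemma supp_sub D1 D2 x : D1 `<=` D2 -> supp D1 x -> supp D2 x.
Proof. by move=> D12 h i Di; apply: h => /D12. Qed.

Lemma supp_ebasis D i : D i -> supp D (ebasis i).
Proof. by move=> Di k Dk; rewrite ebasisE; case: eqP Dk => // ->. Qed.

Lemma restr_supp D x : supp D (restr D x).
Proof. by move=> i Di; rewrite restrE memNset. Qed.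

Lemma restr_id D x : supp D x -> restr D x = x.
Proof.
move=> h; apply: l2P => k; rewrite restrE; case: ifPn => // /negP kD.
by rewrite h// => Dk; apply: kD; rewrite inE.
Qed.

Lemma restrC D x : x = restr D x + restr (~` D) x.
Proof.
apply: l2P => k; rewrite l2D !restrE in_setC.
by case: (k \in D); rewrite ?addr0 ?add0r.
Qed.

Lemma restr_II n x : restr `I_n x = \sum_(j < n) x j *: ebasis j.
Proof.
have -> : `I_n = id @` (setT `&` `I_n) by rewrite image_id setTI.
rewrite (@restr_partial_sum _ id)//; apply: eq_bigl => j; exact: in_setT.
Qed.

Lemma restr_IIS D n x :
  restr (`I_n `&` D) x = \sum_(j < n | (j : nat) \in D) x j *: ebasis j.
Proof.
have -> : `I_n `&` D = id @` (D `&` `I_n) by rewrite image_id setIC.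
by rewrite (@restr_partial_sum _ id).
Qed.

Lemma lspan_supp J (v : nat -> l2 R) D :
  (forall j, J j -> supp D (v j)) -> lspan J v `<=` supp D.
Proof.
move=> h _ [n [c ->]]; apply: supp_sum => j /set_mem /h; exact: suppZ.
Qed.

(** A vector with a nonzero coordinate [i] off the image of [p] stays at distance at least [|x i|]
    from the span. Conversely, the partial expansions of a supported vector converge to it. *)
Lemma closure_lspan_ebasis J (v : nat -> l2 R) (p : nat -> nat) : set_inj J p ->
  (forall j, J j -> v j = ebasis (p j)) ->
  closure (lspan J v) = supp (p @` J).
Proof.
move=> pinj vp; apply/seteqP; split=> x.
  move=> cx i Di; apply: Normc.eq0_normc; apply/eqP/negPn/negP => xi.
  have xi0 : 0 < normc (x i) by rewrite lt_neqAle eq_sym xi normc_ge0.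
  have /cx[y [yJ]] : nbhs x (ball x (normc (x i))%:C%C).
    by apply: nbhsx_ballx; rewrite ltcR.
  rewrite -ball_normE /ball_ /= l2_normE ltcR.
  have yi : y i = 0.
    apply: (lspan_supp _ yJ) Di => j Jj; rewrite vp//.
    by apply: supp_ebasis; exists j.
  have := normc_coord (x - y) i; rewrite l2B yi subr0 => h1 h2.
  by move: (le_lt_trans h1 h2); rewrite ltxx.
move=> sx; have := restr_partial_sum_cvg x pinj; rewrite restr_id//.
move=> /l2_cvgP xc B /xc[N _ /(_ N (leqnn _))] BN.
exists (\sum_(j < N | (j : nat) \in J) x (p j) *: ebasis (p j)); split => //.
exists N, (x \o p); apply: eq_bigr => j Jj; rewrite vp//; exact: set_mem.
Qed.

End Restriction.

(** * Finite families *)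

Section LinearAlgebra.
Variable F : fieldType.

(* The matrix [a] on [D] is completed by the identity off [D]. *)
Lemma inverse_of_injective n (D : {pred 'I_n}) (a : 'I_n -> 'I_n -> F) :
  (forall c : 'I_n -> F,
     (forall k, k \in D -> \sum_(i | i \in D) c i * a i k = 0) ->
     forall i, i \in D -> c i = 0) ->
  exists b : 'I_n -> 'I_n -> F, {in D &, forall i k,
    \sum_(l | l \in D) b i l * a l k = (i == k)%:R /\
    \sum_(l | l \in D) a i l * b l k = (i == k)%:R}.
Proof.
move=> ainj.
pose B := \matrix_(i, k) if (i \in D) && (k \in D) then a i k else (i == k)%:R.
have BD (f : 'I_n -> F) k : k \in D ->
    \sum_i f i * B i k = \sum_(i | i \in D) f i * a i k.
  move=> kD; rewrite (bigID (mem D))/= [X in _ + X]big1 ?addr0.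
    by apply: eq_bigr => i iD; rewrite mxE iD kD.
  move=> i iD; rewrite mxE (negbTE iD) /=; case: eqP => [ik|]; rewrite ?mulr0//.
  by rewrite ik kD in iD.
have DB (f : 'I_n -> F) k : k \in D ->
    \sum_i B k i * f i = \sum_(i | i \in D) a k i * f i.
  move=> kD; rewrite (bigID (mem D))/= [X in _ + X]big1 ?addr0.
    by apply: eq_bigr => i iD; rewrite mxE iD kD.
  move=> i iD; rewrite mxE (negbTE iD) andbF; case: eqP => [ik|]; rewrite ?mul0r//.
  by rewrite -ik kD in iD.
have Bu : B \in unitmx.
  rewrite -row_free_unit; apply: inj_row_free => v /rowP vB.
  have vD k : k \in D -> v 0 k = 0.
    apply: (ainj (fun i => v 0 i)) => l lD.
    by rewrite -(BD (fun i => v 0 i))//; have := vB l; rewrite !mxE.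
  apply/rowP => k; rewrite [RHS]mxE; case: (boolP (k \in D)) => [/vD//|kD].
  have := vB k; rewrite !mxE (bigD1 k)//= mxE (negbTE kD) /= eqxx mulr1 big1 ?addr0//.
  by move=> i /negbTE ik; rewrite mxE (negbTE kD) andbF ik mulr0.
exists (fun i k => invmx B i k) => i k iD kD; split.
  by rewrite -(BD (fun l => invmx B i l))//;
    have /matrixP/(_ i k) := mulVmx Bu; rewrite !mxE.
by rewrite -(DB (fun l => invmx B l k))//;
  have /matrixP/(_ i k) := mulmxV Bu; rewrite !mxE.
Qed.

(** Otherwise [n] rows of length [m] would be independent, against the bound of the rank by the
    number of columns. *)
Lemma kernel_of_wide n m (a : 'I_n -> 'I_m -> F) : (m < n)%N ->
  exists2 c : 'I_n -> F, (forall k, \sum_i c i * a i k = 0) &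
    exists i, c i != 0.
Proof.
move=> mn; apply: contrapT => h.
suff : row_free (\matrix_(i, k) a i k).
  by rewrite /row_free => /eqP rk; have := rank_leq_col (\matrix_(i, k) a i k);
    rewrite rk leqNgt mn.
apply: inj_row_free => v /rowP vB; apply/rowP => i; rewrite [RHS]mxE.
apply/eqP/negPn/negP => vi; apply: h; exists (fun i => v 0 i); last by exists i.
move=> k; have := vB k; rewrite !mxE => h'; rewrite -[RHS]h'.
by apply: eq_bigr => l _; rewrite mxE.
Qed.

End LinearAlgebra.

Section FreeFamilies.
Variable R : realType.
Implicit Types (x y z w : l2 R) (D J : set nat) (u v g : nat -> l2 R).
Local Notation normc := (@Normc.normc R).

(** Matrix arguments yield coefficients on ordinals, whereas freeness is stated for functions on
    [nat]; the extension is 0 from [n] on. *)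
Definition extend_ord n (c : 'I_n -> R[i]) (j : nat) : R[i] :=
  oapp c 0 (insub j).

Lemma extend_ordE n (c : 'I_n -> R[i]) (i : 'I_n) : extend_ord c i = c i.
Proof. by rewrite /extend_ord valK. Qed.

Definition free_below n D v := forall c : nat -> R[i],
  \sum_(j < n | (j : nat) \in D) c j *: v j = 0 ->
  forall j, (j < n)%N -> D j -> c j = 0.

Lemma lspan_mem J v j : J j -> lspan J v (v j).
Proof.
move=> Jj; exists j.+1, (fun k => (k == j)%:R).
rewrite (bigD1 (Ordinal (ltnSn j)))/= ?mem_set// eqxx scale1r big1 ?addr0//.
by move=> i /andP[_ /negbTE]; rewrite -val_eqE /= => ->; rewrite scale0r.
Qed.

Lemma supp_sumE n D x : supp (`I_n `&` D) x ->
  x = \sum_(j < n | (j : nat) \in D) x j *: ebasis j.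
Proof. by move=> sx; rewrite -restr_IIS restr_id. Qed.

(** The coordinates of the [g k] on the indices of [D] below [n] form a square matrix. Freeness
    makes it invertible, and its inverse expresses each [ebasis j] through the [g k]. *)
Lemma free_spans_supp n D g :
  (forall k, (k < n)%N -> D k -> supp (`I_n `&` D) (g k)) -> free_below n D g ->
  forall x, supp (`I_n `&` D) x ->
  exists c : nat -> R[i], x = \sum_(k < n | (k : nat) \in D) c k *: g k.
Proof.
move=> gD gfree x xD.
have gE (k : 'I_n) : (k : nat) \in D ->
    g k = \sum_(j < n | (j : nat) \in D) g k j *: ebasis j.
  by move=> kD; apply: supp_sumE; apply: gD => //; exact: set_mem.
have [|b hb] := @inverse_of_injective _ n [pred i : 'I_n | (i : nat) \in D]
    (fun i k => g i k).
  move=> c ck i iD; rewrite -(extend_ordE c); apply: gfree => //; last exact: set_mem.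
  apply: l2P => k; rewrite l2sum l20.
  have [kn|kn] := ltnP k n; last first.
    apply: big1 => j /set_mem Dj; rewrite l2Z (gD j)//= ?mulr0//.
    by move=> [/= kn' _]; rewrite leqNgt kn' in kn.
  have [kD|kD] := boolP (k \in D); last first.
    apply: big1 => j /set_mem Dj; rewrite l2Z (gD j)//= ?mulr0//.
    by move=> [_ /mem_set]; apply/negP.
  rewrite -[RHS](ck (Ordinal kn))//; apply: eq_bigr => j _.
  by rewrite l2Z extend_ordE.
exists (extend_ord (fun l => \sum_(j < n | (j : nat) \in D) x j * b j l)).
under eq_bigr => k _ do rewrite extend_ordE scaler_suml.
rewrite exchange_big /= {1}(supp_sumE xD); apply: eq_bigr => j jD.
under eq_bigr => k kD do rewrite -scalerA (gE k kD) scaler_sumr.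
rewrite -scaler_sumr exchange_big /=; congr (_ *: _).
rewrite (bigD1 j)//=.
under eq_bigr => k _ do rewrite scalerA.
rewrite -scaler_suml (hb _ _ _ _).1// eqxx scale1r big1 ?addr0// => k /andP[kD kj].
under eq_bigr => l _ do rewrite scalerA.
by rewrite -scaler_suml (hb _ _ _ _).1// eq_sym (negbTE kj) scale0r.
Qed.

(* If [c] is in the kernel of the Gram matrix, [|sum_j c_j v_j|^2 = 0]. *)
Lemma gram_inverse n D v : free_below n D v ->
  exists b : 'I_n -> 'I_n -> R[i], forall i k : 'I_n,
    (i : nat) \in D -> (k : nat) \in D ->
    \sum_(l < n | (l : nat) \in D) b i l * dot (v l) (v k) = (i == k)%:R /\
    \sum_(l < n | (l : nat) \in D) dot (v i) (v l) * b l k = (i == k)%:R.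
Proof.
move=> vfree.
have [|b hb] := @inverse_of_injective _ n [pred i : 'I_n | (i : nat) \in D]
    (fun i k => dot (v i) (v k)); last by exists b => i k; exact: hb.
move=> c ck i iD; rewrite -(extend_ordE c); apply: vfree => //; last exact: set_mem.
set y := \sum_(j < n | _) _; apply: dotxx_eq0.
rewrite {2}/y dot_sumr big1// => k kD; rewrite dotZr /y dot_suml.
rewrite (_ : \sum_(_ < _ | _) _ = 0) ?mulr0// -[RHS](ck k)//.
by apply: eq_bigr => j _; rewrite dotZl extend_ordE.
Qed.

(** With [b] the inverse Gram matrix and [y] the sum, [c j] is the sum of the [<y, v k> b k j];
    Cauchy-Schwarz bounds each term. Summing over [j] as well makes [K] uniform in [j]. *)
Lemma free_coef_bound n D v : free_below n D v ->
  exists2 K : R, 0 <= K & forall (c : nat -> R[i]) j, (j < n)%N -> D j ->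
    normc (c j) <= K * l2norm (\sum_(j < n | (j : nat) \in D) c j *: v j).
Proof.
move=> /gram_inverse[b hb].
pose K := \sum_(j < n) \sum_(k < n) l2norm (v k) * normc (b k j).
have K0 (j : 'I_n) : 0 <= \sum_(k < n) l2norm (v k) * normc (b k j).
  by apply: sumr_ge0 => k _; rewrite mulr_ge0 ?l2norm_ge0 ?normc_ge0.
exists K; first by apply: sumr_ge0 => j _.
move=> c j jn Dj; set y := \sum_(j < n | _) _.
have -> : c j = \sum_(k < n | (k : nat) \in D) dot y (v k) * b k (Ordinal jn).
  rewrite /y; under eq_bigr => k _ do rewrite dot_suml mulr_suml.
  rewrite exchange_big /= (bigD1 (Ordinal jn)) ?mem_set//=.
  under eq_bigr => k _ do rewrite dotZl -mulrA.
  rewrite -mulr_sumr (hb (Ordinal jn) _ _ _).2 ?mem_set// eqxx mulr1 big1 ?addr0//.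
  move=> i /andP[iD ij]; under eq_bigr => k _ do rewrite dotZl -mulrA.
  by rewrite -mulr_sumr (hb i (Ordinal jn) iD (mem_set Dj)).2 (negbTE ij) mulr0.
apply: (le_trans (normc_sum _ _ _)).
apply: (@le_trans _ _ (\sum_(k < n) l2norm (v k) * normc (b k (Ordinal jn)) * l2norm y)).
  rewrite big_mkcond; apply: ler_sum => k _; case: ifP => _; last first.
    by rewrite !mulr_ge0 ?l2norm_ge0 ?normc_ge0.
  rewrite Normc.normcM mulrAC ler_wpM2r ?normc_ge0// mulrC; exact: cauchy_schwarz.
rewrite -mulr_suml ler_wpM2r ?l2norm_ge0// /K [leRHS](bigD1 (Ordinal jn))//= lerDl.
by apply: sumr_ge0 => i _.
Qed.

(** These are the normal equations, solved by the inverse Gram matrix. *)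
Lemma free_orthogonal_projection n D v w : free_below n D v ->
  exists c : nat -> R[i], forall k, (k < n)%N -> D k ->
    dot (w - \sum_(j < n | (j : nat) \in D) c j *: v j) (v k) = 0.
Proof.
move=> /gram_inverse[b hb].
exists (extend_ord (fun j => \sum_(l < n | (l : nat) \in D) dot w (v l) * b l j)).
move=> k kn Dk; rewrite dotBl dot_suml.
under eq_bigr => j _ do rewrite extend_ordE dotZl mulr_suml.
rewrite exchange_big /= (bigD1 (Ordinal kn)) ?mem_set//=.
under eq_bigr => l _ do rewrite -mulrA.
rewrite -mulr_sumr (hb (Ordinal kn) (Ordinal kn) _ _).1 ?mem_set// eqxx mulr1.
rewrite big1 ?addr0 ?subrr// => i /andP[iD ij].
under eq_bigr => l _ do rewrite -mulrA.
by rewrite -mulr_sumr (hb i (Ordinal kn) iD (mem_set Dk)).1 (negbTE ij) mulr0.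
Qed.

Lemma sum_II n (f : nat -> l2 R) :
  \sum_(j < n | (j : nat) \in `I_n) f j = \sum_(j < n) f j.
Proof. by apply: eq_bigl => j; rewrite mem_set//=. Qed.

Lemma sum_truncate m n (f : nat -> l2 R) :
  \sum_(j < m | (j : nat) \in `I_n) f j =
  \sum_(j < n) if (j < m)%N then f j else 0.
Proof.
rewrite -big_mkcond (eq_bigl (fun j : 'I_m => (j < n)%N)); last first.
  by move=> j; apply/idP/idP => [/set_mem//|jn]; exact: mem_set.
rewrite (big_ord_widen_cond _ (fun j => (j < n)%N) f (leq_maxl m n)).
rewrite (big_ord_widen_cond _ (fun j => (j < m)%N) f (leq_maxr m n)).
by apply: eq_bigl => j; rewrite andbC.
Qed.

Lemma lspan_II n v x : lspan `I_n v x ->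
  exists c : nat -> R[i], x = \sum_(j < n) c j *: v j.
Proof.
move=> [m [c ->]]; exists (fun j => if (j < m)%N then c j else 0).
rewrite (@sum_truncate m n (fun j => c j *: v j)); apply: eq_bigr => j _.
by case: (j < m)%N; rewrite ?scale0r.
Qed.

Lemma lin_indep_free n v : lin_indep `I_n v <-> free_below n setT v.
Proof.
split=> h.
  move=> c; rewrite (eq_bigl xpredT) => [|j]; last exact: in_setT.
  by rewrite -(@sum_II n (fun j => c j *: v j)) => /h cj j jn _; exact: cj.
move=> m c c0 j jm jn.
pose d k := if (k < m)%N then c k else 0.
suff : d j = 0 by rewrite /d jm.
apply: (h d) => //.
rewrite (eq_bigl xpredT) => [|i]; last exact: in_setT.
rewrite -[RHS]c0 (@sum_truncate m n (fun j => c j *: v j)); apply: eq_bigr => i _.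
by rewrite /d; case: (i < m)%N; rewrite ?scale0r.
Qed.

(** If [m < k], the [k] by [m] matrix expressing the [u j] through the [v i] has a nontrivial left
    kernel, which is a linear relation between the [u j]. *)
Lemma lin_indep_le_dim k m u v : lin_indep `I_k u ->
  (forall j, (j < k)%N -> lspan `I_m v (u j)) -> (k <= m)%N.
Proof.
move=> /lin_indep_free uf uv; rewrite leqNgt; apply/negP => mk.
have /choice[a ha] : forall j : 'I_k, exists c : nat -> R[i],
    u j = \sum_(i < m) c i *: v i.
  by move=> j; apply: lspan_II; exact: uv.
have [c cK [i ci]] := @kernel_of_wide _ k m (fun j i => a j i) mk.
move/negP: ci; apply; rewrite -(extend_ordE c); apply/eqP/uf => //.
rewrite (eq_bigl xpredT) => [|j]; last exact: in_setT.
under eq_bigr => j _ do rewrite extend_ordE ha scaler_sumr.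
rewrite exchange_big big1//= => l _.
under eq_bigr => j _ do rewrite scalerA.
by rewrite -scaler_suml cK scale0r.
Qed.

End FreeFamilies.

(** * Unitary operators and QR sequences *)

Section LinearMaps.
Variable R : realType.
Variables (T : l2 R -> l2 R) (Tlin : linear T).
Implicit Types (x y : l2 R).

Lemma linear_mapD x y : T (x + y) = T x + T y.
Proof. by rewrite -{1}[x]scale1r Tlin scale1r. Qed.

Lemma linear_map0 : T 0 = 0.
Proof. by apply: (addrI (T 0)); rewrite -linear_mapD !addr0. Qed.

Lemma linear_mapZ (a : R[i]) x : T (a *: x) = a *: T x.
Proof. by rewrite -[a *: x]addr0 Tlin linear_map0 addr0. Qed.

Lemma linear_mapB x y : T (x - y) = T x - T y.
Proof. by rewrite linear_mapD -scaleN1r linear_mapZ scaleN1r. Qed.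

Lemma linear_map_sum (I : Type) (s : seq I) (p : pred I) (f : I -> l2 R) :
  T (\sum_(i <- s | p i) f i) = \sum_(i <- s | p i) T (f i).
Proof.
by elim/big_rec2: _ => [|i a b _ <-]; rewrite ?linear_map0 ?linear_mapD.
Qed.

Lemma linear_map_sumZ (I : Type) (s : seq I) (p : pred I) (c : I -> R[i]) (f : I -> l2 R) :
  T (\sum_(i <- s | p i) c i *: f i) = \sum_(i <- s | p i) c i *: T (f i).
Proof. by rewrite linear_map_sum; apply: eq_bigr => i _; rewrite linear_mapZ. Qed.

Lemma iter_linear n : linear (iter n T).
Proof. by move=> a x y; elim: n => //= n ->; rewrite Tlin. Qed.

End LinearMaps.

Section Isometries.
Variable R : realType.
Implicit Types (x y a b : l2 R) (U V : l2 R -> l2 R).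
Local Notation normc := (@Normc.normc R).

Lemma normc_dotxx x : normc (dot x x) = l2norm x ^+ 2.
Proof. by rewrite dotxx normc_real ger0_norm ?sqr_ge0. Qed.

(** Cauchy-Schwarz divided by [|a|]. This gives the contraction property of projections and of
    adjoints of unitaries. *)
Lemma l2norm_le_of_dot a b : dot a a = dot a b -> l2norm a <= l2norm b.
Proof.
move=> ab; have := cauchy_schwarz a b; rewrite -ab normc_dotxx expr2.
have [->|a0] := eqVneq (l2norm a) 0; first by rewrite l2norm_ge0.
by rewrite ler_pM2l// lt_neqAle eq_sym a0 l2norm_ge0.
Qed.

Lemma linear_bounded_comp U V :
  bounded_operator U -> bounded_operator V -> bounded_operator (U \o V).
Proof.
move=> [Ul [B hB]] [Vl [C hC]]; split; first by move=> c x y; rewrite /= Vl Ul.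
exists (`|B| * C) => x; apply: (le_trans (hB _)).
apply: (@le_trans _ _ (`|B| * l2norm (V x))).
  by rewrite ler_wpM2r ?l2norm_ge0// ler_norm.
by rewrite -mulrA ler_wpM2l.
Qed.

Lemma unitary_id : unitary_operator (id : l2 R -> l2 R).
Proof.
split; first by split => //; exists 1 => x; rewrite mul1r.
by exists id.
Qed.

Lemma unitary_comp U V :
  unitary_operator U -> unitary_operator V -> unitary_operator (U \o V).
Proof.
move=> [Ub [A [UA AU UAid]]] [Vb [B [VB BV VBid]]]; split.
  exact: linear_bounded_comp.
exists (B \o A); split.
- by move=> x y; rewrite /= UA VB.
- by apply/funext => x /=; rewrite -[A _]/((A \o U) (V x)) AU -[B _]/((B \o V) x) BV.
- apply/funext => x /=.
  by rewrite -[V (B _)]/((V \o B) (A x)) VBid -[U (A x)]/((U \o A) x) UAid.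
Qed.

Lemma unitary_linear U : unitary_operator U -> linear U.
Proof. by case=> -[]. Qed.

Lemma unitary_dot U x y : unitary_operator U -> dot (U x) (U y) = dot x y.
Proof. by move=> [_ [A [UA AU _]]]; rewrite UA -[A _]/((A \o U) y) AU. Qed.

Lemma unitary_norm U x : unitary_operator U -> l2norm (U x) = l2norm x.
Proof.
move=> hU; have := normc_dotxx (U x); rewrite unitary_dot// normc_dotxx => /esym/eqP.
by rewrite eqrXn2 ?l2norm_ge0// => /eqP.
Qed.

Lemma coord_sum_ebasis n (D : set nat) (c : nat -> R[i]) k : (k < n)%N -> D k ->
  (\sum_(j < n | (j : nat) \in D) c j *: ebasis j : l2 R) k = c k.
Proof.
move=> kn Dk; rewrite l2sum (bigD1 (Ordinal kn)) ?mem_set//= l2Z ebasisE eqxx mulr1.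
rewrite big1 ?addr0// => i /andP[_ ik]; rewrite l2Z ebasisE.
by rewrite [k == i]eq_sym -[k]/(val (Ordinal kn)) val_eqE (negbTE ik) mulr0.
Qed.

Lemma upper_triangular_supp U m x :
  linear U -> upper_triangular U -> supp `I_m x -> supp `I_m (U x).
Proof.
move=> Ul Uu xm; rewrite -(restr_id xm) restr_II linear_map_sumZ//.
apply: supp_sum => j _; apply: suppZ => i im.
rewrite -dot_ebasis; apply: Uu.
by apply: (leq_trans (ltn_ord j)); rewrite leqNgt; apply/negP.
Qed.

(** An injective endomorphism of a finite-dimensional space is onto: the images of the basis vectors
    are free, hence span. *)
Lemma injective_onto_supp U m x : linear U -> (forall y, U y = 0 -> y = 0) ->
  (forall y, supp `I_m y -> supp `I_m (U y)) -> supp `I_m x ->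
  exists2 y, supp `I_m y & U y = x.
Proof.
move=> Ul Uinj Um xm.
have [|||c ->] := @free_spans_supp _ m setT (fun k => U (ebasis k)) _ _ x.
- by move=> k km _; rewrite setIT; apply: Um; exact: supp_ebasis.
- move=> c; rewrite -(linear_map_sumZ Ul) => /Uinj c0 j jm _.
  by rewrite -(@coord_sum_ebasis m setT c)// c0.
- by rewrite setIT.
exists (\sum_(k < m | (k : nat) \in setT) c k *: ebasis k).
  apply: supp_sum => k _; apply: suppZ; apply: supp_ebasis; exact: ltn_ord.
exact: (linear_map_sumZ Ul).
Qed.

End Isometries.

(** * QR sequences and the iterates of [T] *)

Section QR.
Variable R : realType.
Variables (T : l2 R -> l2 R) (Q_ R_ : nat -> l2 R -> l2 R).
Hypotheses (T_lin : linear T) (T_inj : forall x, T x = 0 -> x = 0).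
Hypothesis QR_T : QR_sequences T Q_ R_.
Implicit Types (x y z : l2 R).

Lemma QR_unitary n : unitary_operator (Q_ n).
Proof.
case: QR_T => T_ [Qf [Rf [_ QRf [Q0 QS] _]]].
elim: n => [|n IH]; first by rewrite Q0; exact: unitary_id.
by rewrite QS; apply: unitary_comp => //; case: (QRf n).
Qed.

Lemma QR_power n x : iter n T x = Q_ n (R_ n x).
Proof.
case: QR_T => T_ [Qf [Rf [T0 QRf [Q0 QS] [R0 RS]]]].
(* Intertwining: with [T_m = Q R] and [T_{m+1} = R Q], one has [Q_{m+1} T_{m+1} = Q_m Q R Q = Q_m
   T_m Q = T Q_m Q = T Q_{m+1}]. *)
have QT m y : Q_ m (T_ m y) = T (Q_ m y).
  elim: m y => [|m IH] y; first by rewrite Q0 T0.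
  have [_ _ _ hT hT'] := QRf m.
  by rewrite QS hT' /= -[Qf _ (Rf _ _)]/((Qf m.+1 \o Rf m.+1) _) -hT IH.
elim: n => [|n IH]; first by rewrite Q0 R0.
have [_ _ _ hT _] := QRf n.
rewrite /= IH RS QS /= -[Qf _ (Rf _ _)]/((Qf n.+1 \o Rf n.+1) _) -hT QT //.
Qed.

Lemma QR_R_linear n : linear (R_ n).
Proof.
case: QR_T => T_ [Qf [Rf [_ QRf _ [R0 RS]]]].
elim: n => [|n IH]; first by rewrite R0.
by move=> a x y; rewrite RS /= IH; case: (QRf n) => _ [-> _].
Qed.

Lemma QR_R_supp n m x : supp `I_m x -> supp `I_m (R_ n x).
Proof.
case: QR_T => T_ [Qf [Rf [_ QRf _ [R0 RS]]]].
elim: n => [|n IH]; first by rewrite R0.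
move=> /IH xm; rewrite RS /=; case: (QRf n) => _ [Rl _] Ru _ _.
exact: upper_triangular_supp.
Qed.

Lemma iter_injective n x : iter n T x = 0 -> x = 0.
Proof. by elim: n => //= n IH /T_inj. Qed.

Lemma QR_of_iter n m x : supp `I_m x ->
  exists2 y, supp `I_m y & iter n T x = Q_ n y.
Proof.
by move=> xm; exists (R_ n x); [exact: QR_R_supp|exact: QR_power].
Qed.

(** [R_ n] is injective because [T^n] is, and it preserves the span of the first [m] basis vectors;
    being onto there, it can be inverted on [x]. *)
Lemma QR_iter_of n m x : supp `I_m x ->
  exists2 y, supp `I_m y & Q_ n x = iter n T y.
Proof.
move=> xm; have [||y ym <-] := injective_onto_supp (@QR_R_linear n) _ _ xm.
- move=> y Ry; apply: (@iter_injective n); rewrite QR_power Ry.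
  by rewrite (linear_map0 (unitary_linear (QR_unitary n))).
- by move=> y; exact: QR_R_supp.
by exists y => //; rewrite QR_power.
Qed.

End QR.

(** * Pivots *)

Section Pivots.
Variable R : realType.
Variable P : l2 R -> l2 R.
Hypotheses (P_lin : linear P) (P_idem : forall x, P (P x) = P x).
Hypothesis P_adj : is_adjoint P P.
Implicit Types (x y z g : l2 R).
Local Notation normc := (@Normc.normc R).

Lemma proj_le x : l2norm (P x) <= l2norm x.
Proof. by apply: l2norm_le_of_dot; rewrite -P_adj P_idem. Qed.

Lemma coproj_le x : l2norm (x - P x) <= l2norm x.
Proof.
apply: l2norm_le_of_dot; rewrite [LHS]dotBr -P_adj (linear_mapB P_lin) P_idem.
by rewrite addrN [dot 0 x]dot0l subr0.
Qed.

(* The indices of the basis vectors picked greedily so that their projections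
   form a basis of the span of all the [P e_i]. *)
Definition pivots : set nat :=
  [set i | ~ exists2 g, supp `I_i g & P (ebasis i) = P g].

Lemma nonpivot i : ~ pivots i -> exists2 g, supp `I_i g & P (ebasis i) = P g.
Proof. exact: contrapT. Qed.

Lemma supp_IIS D m x : supp (`I_m.+1 `&` D) x ->
  exists2 y, supp (`I_m `&` D) y & x = y + x m *: ebasis m.
Proof.
move=> xm; exists (x - x m *: ebasis m); last by rewrite subrK.
move=> i imD; rewrite l2B l2Z ebasisE; case: eqVneq => [->|im].
  by rewrite mulr1 subrr.
rewrite mulr0 subr0 xm// => -[/= iS Di]; apply: imD; split => //=.
by rewrite ltn_neqAle im -ltnS.
Qed.

Lemma supp_IIS_setT m x : supp `I_m.+1 x ->
  exists2 y, supp `I_m y & x = y + x m *: ebasis m.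
Proof.
by move=> xm; have := @supp_IIS setT m x; rewrite !setIT; exact.
Qed.

Lemma supp_II_le D m m' x : (m <= m')%N -> supp (`I_m `&` D) x -> supp (`I_m' `&` D) x.
Proof.
by move=> mm; apply: supp_sub => i [/= im Di]; split=> //=; exact: leq_trans mm.
Qed.

(** By induction on [m]: when [m] is not a pivot, [ebasis m] is traded for an earlier combination
    with the same projection. *)
Lemma pivot_reduction m y : supp `I_m y ->
  exists2 g, supp (`I_m `&` pivots) g & P g = P y.
Proof.
elim: m y => [|m IH] y ym; first by exists y => // i _; apply: ym.
have [y' y'm ->] := supp_IIS_setT ym.
have [mS|/nonpivot[g' g'm Pg']] := pselect (pivots m).
  have [g gm Pg] := IH _ y'm.
  exists (g + y m *: ebasis m); last by rewrite !(linear_mapD P_lin) Pg.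
  apply: suppD; first exact: supp_II_le gm.
  by apply/suppZ/supp_ebasis; split => /=.
have [|g gm Pg] := IH (y' + y m *: g').
  by apply: suppD => //; exact: suppZ.
exists g; first exact: supp_II_le gm.
by rewrite Pg !(linear_mapD P_lin) !(linear_mapZ P_lin) Pg'.
Qed.

(** A nonzero coefficient at the largest index, once divided out, would write the projection of that
    basis vector through earlier ones, so the index would not be a pivot. *)
Lemma pivot_independence m g : supp (`I_m `&` pivots) g -> P g = 0 -> g = 0.
Proof.
elim: m g => [|m IH] g gm Pg0.
  by apply: l2P => i; apply: gm => -[].
have [y ym gE] := supp_IIS gm.
suff gm0 : g m = 0 by move: gE; rewrite gm0 scale0r addr0 => gE; apply: IH; rewrite // gE.
apply: contrapT => /eqP gm0.
have : pivots m by apply: contrapT => mS; move/eqP: gm0; apply; apply: gm => -[].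
apply; exists (- (g m)^-1 *: y); first by apply: suppZ; apply: supp_sub ym => i [].
apply: (@scalerI _ _ (g m)) => //.
rewrite (linear_mapZ P_lin) scalerA mulrN divff// scaleN1r.
apply/eqP; rewrite -addr_eq0 addrC -(linear_mapZ P_lin) -(linear_mapD P_lin) -gE.
by rewrite Pg0.
Qed.

Lemma pivot_free m : free_below m pivots (fun j => P (ebasis j)).
Proof.
move=> c; rewrite -(linear_map_sumZ P_lin) => /(@pivot_independence m) c0 j jm jS.
rewrite -(@coord_sum_ebasis R m pivots c)// c0//.
by apply: supp_sum => k /set_mem kS; apply/suppZ/supp_ebasis; split => //=.
Qed.

(** A finite span of pivot vectors meets the kernel of [P] trivially, so [P] is bounded below on it.
    This [K] becomes the constant in [pivot_estimate]. *)
Lemma pivot_lower_bound m :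
  exists2 K : R, 0 <= K &
    forall g, supp (`I_m `&` pivots) g -> l2norm g <= K * l2norm (P g).
Proof.
have [K K0 hK] := free_coef_bound (@pivot_free m).
exists (\sum_(j < m) K); first exact: sumr_ge0.
move=> g gm; have := hK (fun j => g j).
rewrite -(linear_map_sumZ P_lin) -supp_sumE// => hg.
rewrite {1}(supp_sumE gm); apply: (le_trans (l2norm_sum _ _ _)).
rewrite big_mkcond mulr_suml; apply: ler_sum => j _.
case: ifP => [jS|_]; last by rewrite mulr_ge0 ?l2norm_ge0.
by rewrite l2normZ l2norm_ebasis mulr1; apply: hg => //; exact: set_mem.
Qed.

(* The residual of the best approximation of [w] is orthogonal to every [P e_i],
   hence vanishes. *)
Lemma pivot_spans m w : pivots `<=` `I_m -> P w = w ->
  exists2 g, supp (`I_m `&` pivots) g & P g = w.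
Proof.
move=> Sm Pw; have [c hc] := free_orthogonal_projection w (@pivot_free m).
rewrite -(linear_map_sumZ P_lin) in hc.
set g := \sum_(j < m | _) _ in hc.
have gm : supp (`I_m `&` pivots) g.
  by apply: supp_sum => k /set_mem kS; apply/suppZ/supp_ebasis; split => //=.
clearbody g; exists g => //; apply/eqP; rewrite eq_sym -subr_eq0; apply/eqP/l2P => i.
rewrite l20 -dot_ebasis.
have wgP : w - P g = P (w - P g) by rewrite (linear_mapB P_lin) P_idem Pw.
rewrite wgP P_adj.
have [h hm <-] : exists2 h, supp (`I_m `&` pivots) h & P h = P (ebasis i).
  have [|h hi Ph] := @pivot_reduction i.+1 (ebasis i).
    by apply: supp_ebasis => /=.
  by exists h => //; apply: supp_sub hi => k [_ kS]; split => //; exact: Sm.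
rewrite (supp_sumE hm) (linear_map_sumZ P_lin) dot_sumr big1// => j /set_mem jS.
by rewrite dotZr hc ?mulr0.
Qed.

End Pivots.

(** * Weak compactness *)

Section Diagonal.
Variable R : realType.

Lemma cvg_of_rate (u : nat -> R) (l : R) (K : nat) :
  (forall k, (K <= k)%N -> `|l - u k| < k.+1%:R^-1) -> u @ \oo --> l.
Proof.
move=> h; apply/(@cvgrPdist_lt _ R^o) => e e0.
near=> k; apply: (@lt_trans _ _ k.+1%:R^-1).
  by apply: h; near: k; exact: nbhs_infty_ge.
by near: k; exact: near_infty_natSinv_lt (PosNum e0).
Unshelve. all: by end_near. Qed.

(* A cluster point of the sequence in a product of segments is the limit of a
   subsequence since only finitely many coordinates matter at each step. *)
Lemma diagonal_subsequence (u : nat -> nat -> R) (B : R) :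
  (forall k i, `|u k i| <= B) ->
  exists psi : nat -> nat, {homo psi : m n / (m < n)%N} /\
    exists l : nat -> R, forall i, (fun k => u (psi k) i) @ \oo --> l i.
Proof.
move=> uB.
pose T := prod_topology (fun _ : nat => R).
have cA : compact [set f : T | forall i, `[- B, B]%classic (f i)].
  exact: (@tychonoff nat (fun=> R) (fun=> `[- B, B]%classic)
    (fun=> @segment_compact R _ _)).
have [|l [_ cl]] := cA ((u : nat -> T) @ \oo) _.
  exists 0%N => // k _ i /=; rewrite in_itv /=; have := uB k i.
  by rewrite ler_norml.
have near_l k : nbhs (l : T) [set f : T | forall i, (i < k)%N -> `|l i - f i| < k.+1%:R^-1].
  have : forall m, nbhs (l : T) [set f : T | forall i, (i < m)%N -> `|l i - f i| < k.+1%:R^-1].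
    elim=> [|m IH]; first by apply: filterS filterT => f _ i.
    have : nbhs (l : T) [set f : T | `|l m - f m| < k.+1%:R^-1].
      apply: (@proj_continuous nat (fun=> R) m l [set r : R | `|l m - r| < k.+1%:R^-1]).
      have := @nbhsx_ballx R R^o (l m) k.+1%:R^-1.
      by rewrite -ball_normE; apply; rewrite invr_gt0.
    apply: filterS2 IH => f hf hm i; rewrite ltnS leq_eqVlt => /orP[/eqP ->//|].
    exact: hf.
  exact.
(* [sel (N, k)] is a rank beyond [N] at which the first [k] coordinates are within [1/(k+1)] of the
   cluster point. Since [psi k] is chosen with its own [k], coordinate [i] is controlled from [i.+1]
   on. *)
have /choice[sel hsel] : forall Nk : nat * nat, exists n,
    (Nk.1 < n)%N /\ forall i, (i < Nk.2)%N -> `|l i - u n i| < Nk.2.+1%:R^-1.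
  move=> [N k]; have [|f [[n /= Nn <-] hn]] := cl (u @` [set n | (N < n)%N]) _ _ (near_l k).
    by exists N.+1 => // n /= Nn; exists n.
  by exists n.
pose psi := fix psi k := if k is k'.+1 then sel (psi k', k) else sel (0%N, 0%N).
exists psi; split.
  by apply: homo_ltn => [|k]; [exact: ltn_trans|exact: (hsel (psi k, k.+1)).1].
exists l => i; apply: (@cvg_of_rate _ _ i.+1) => -[//|k] ik.
exact: (hsel (psi k, k.+1)).2.
Qed.

(** A uniform limit of convergent sequences is Cauchy: the limit of a close [v] serves as an
    approximate limit of [u]. *)
Lemma cvg_of_approx (u : nat -> R) :
  (forall e, 0 < e -> exists2 v : nat -> R, cvgn v & forall k, `|u k - v k| <= e) ->
  cvgn u.
Proof.
move=> h; apply: cauchy_cvg; apply: cauchy_exP => e e0.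
have e2 : 0 < e / 2 by rewrite divr_gt0.
have e4 : 0 < e / 4 by rewrite divr_gt0.
have [v cv uv] := h _ e4.
exists (limn v); have /(@cvgrPdist_lt _ R^o)/(_ _ e2) := cv.
apply: filterS => k vk; rewrite -ball_normE /ball_ /=.
have := uv k; have := ler_normD (limn v - v k) (v k - u k).
rewrite addrA subrK (distrC (v k)) => h1 h2.
lra.
Qed.

Lemma cvg0_of_approx (f : nat -> R) : (forall k, 0 <= f k) ->
  (forall e, 0 < e -> exists2 g : nat -> R,
    g k @[k --> \oo] --> (0 : R) & forall k, f k <= e + g k) ->
  f k @[k --> \oo] --> (0 : R).
Proof.
move=> f0 h; apply/(@cvgrPdist_lt _ R^o) => e e0.
have e2 : 0 < e / 2 by rewrite divr_gt0.
have [g /(@cvgrPdist_lt _ R^o)/(_ _ e2) g0 fg] := h _ e2.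
apply: filterS g0 => k; rewrite !sub0r !normrN => gk.
rewrite ger0_norm//; apply: (le_lt_trans (fg k)).
have := ler_norm (g k); lra.
Qed.

Lemma le_of_cvg0 (a : R) (f : nat -> R) : f k @[k --> \oo] --> (0 : R) ->
  (\forall k \near \oo, a <= f k) -> a <= 0.
Proof.
move=> f0 af; have <- : limn f = 0 by apply: (@cvg_lim R^o).
apply: limr_ge => //.
exact: cvgP f0.
Qed.

End Diagonal.

Section WeakCompactness.
Variable R : realType.
Implicit Types (x y z : l2 R) (As : nat -> l2 R -> l2 R).
Local Notation normc := (@Normc.normc R).

Lemma complex_cvg_unique (u : nat -> R[i]) (l l' : R[i]) :
  u @ \oo --> (l : R[i]^o) -> u @ \oo --> (l' : R[i]^o) -> l = l'.
Proof.
move=> /complex_cvg0P ul /complex_cvg0P ul'; apply/eqP; rewrite -subr_eq0.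
apply/eqP/Normc.eq0_normc/eqP; rewrite eq_le normc_ge0 andbT.
apply: (le_of_cvg0 (cvg0D ul ul')); apply: nearW => k.
rewrite (normcB l' (u k)); apply: le_trans (le_normcD _ _).
by rewrite addrA subrK.
Qed.

Lemma complex_cvg_linear (a : R[i]) (u v : nat -> R[i]) (l m : R[i]) :
  u @ \oo --> (l : R[i]^o) -> v @ \oo --> (m : R[i]^o) ->
  (fun k => a * u k + v k) @ \oo --> (a * l + m : R[i]^o).
Proof.
move=> /complex_cvg0P ul /complex_cvg0P vm; apply/complex_cvg0P.
apply: (squeeze0 _ (cvg0D (cvg0Mr (normc a) ul) vm)).
apply: nearW => k; rewrite normc_ge0 /= opprD addrACA -mulrBr.
by apply: (le_trans (le_normcD _ _)); rewrite Normc.normcM mulrC.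
Qed.

Lemma complex_cvg_lincomb n (p : pred 'I_n) (c : 'I_n -> R[i])
    (u : 'I_n -> nat -> R[i]) (l : 'I_n -> R[i]) :
  (forall j, u j @ \oo --> (l j : R[i]^o)) ->
  (fun k => \sum_(j < n | p j) c j * u j k) @ \oo -->
    (\sum_(j < n | p j) c j * l j : R[i]^o).
Proof.
move=> ul; apply/complex_cvg0P.
apply: (@squeeze0 _ _ (fun k => \sum_(j < n | p j) normc (l j - u j k) * normc (c j))).
  apply: nearW => k; rewrite normc_ge0 /= -sumrB.
  apply: (le_trans (normc_sum _ _ _)); apply: ler_sum => j _.
  by rewrite -mulrBr Normc.normcM mulrC.
by apply: cvg0_sum => j _; apply/cvg0Mr/complex_cvg0P.
Qed.

Lemma complex_cvg_of_approx (u : nat -> R[i]) :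
  (forall e : R, 0 < e -> exists v : nat -> R[i], exists2 l : R[i],
     v @ \oo --> (l : R[i]^o) & forall k, normc (u k - v k) <= e) ->
  exists l : R[i], u @ \oo --> (l : R[i]^o).
Proof.
move=> h.
have cRe : cvgn (fun k => complex.Re (u k)).
  apply: cvg_of_approx => e /h[v [l /complex_cvgP vl uv]].
  exists (fun k => complex.Re (v k)).
    apply/cvg_ex; exists (complex.Re l); apply/(@cvgrPdist_lt _ R^o) => d /vl.
    apply: filterS => k; apply: le_lt_trans.
    by rewrite -raddfB; exact: normc_ler_Re.
  by move=> k; apply: le_trans (uv k); rewrite -raddfB; exact: normc_ler_Re.
have cIm : cvgn (fun k => complex.Im (u k)).
  apply: cvg_of_approx => e /h[v [l /complex_cvgP vl uv]].
  exists (fun k => complex.Im (v k)).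
    apply/cvg_ex; exists (complex.Im l); apply/(@cvgrPdist_lt _ R^o) => d /vl.
    apply: filterS => k; apply: le_lt_trans.
    by rewrite -raddfB; exact: normc_ler_Im.
  by move=> k; apply: le_trans (uv k); rewrite -raddfB; exact: normc_ler_Im.
by eexists; exact: cvg_complex cRe cIm.
Qed.

Lemma tail_small x (C e : R) : 0 < e ->
  exists N, C * l2norm (x - restr `I_N x) <= e.
Proof.
move=> e0.
have := cvg0Mr C (tail_cvg0 x).
move=> /(@cvgrPdist_lt _ R^o)/(_ _ e0)[N _ /(_ N (leqnn N))].
rewrite sub0r normrN => h; exists N.
have -> : x - restr `I_N x = restr (~` `I_N) x.
  by rewrite {1}(restrC `I_N x) addrC addKr.
by rewrite mulrC ltW// (le_lt_trans (ler_norm _)).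
Qed.

Lemma l2norm_finite_sum n (c : 'I_n -> R[i]) :
  l2norm (\sum_(j < n) c j *: ebasis j) ^+ 2 = \sum_(j < n) normc (c j) ^+ 2.
Proof.
apply: complexI; rewrite -dotxx dot_suml rmorph_sum; apply: eq_bigr => j _ /=.
rewrite dotZl dotC dot_ebasis l2sum (bigD1 j)//= l2Z ebasisE eqxx mulr1.
rewrite big1 ?addr0 ?mul_conjc// => i ij; rewrite l2Z ebasisE.
by rewrite eq_sym val_eqE (negbTE ij) mulr0.
Qed.

(** A diagonal extraction makes all matrix entries converge. The uniform bound extends this first to
    the coordinates of every [As k x], then to all inner products. *)
Lemma wot_subsequence As (C : R) : (forall k, linear (As k)) ->
  (forall k x, l2norm (As k x) <= C * l2norm x) ->
  exists psi : nat -> nat, {homo psi : m n / (m < n)%N} /\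
    exists A, [/\ linear A, forall x, l2norm (A x) <= C * l2norm x &
                  wot_cvg (fun k => As (psi k)) A].
Proof.
move=> Al AC.
have C0 : 0 <= C.
  have := AC 0%N (ebasis 0); rewrite l2norm_ebasis mulr1; apply: le_trans.
  exact: l2norm_ge0.
(* The code [i] stands for a column [a], a row [b] and a Boolean choosing real or imaginary part;
   codes that decode to nothing get 0. *)
pose u k i : R := if unpickle i is Some (a, b, c) then
    if c then complex.Re (As k (ebasis a) b) else complex.Im (As k (ebasis a) b)
  else 0.
have uC k i : `|u k i| <= C.
  rewrite /u; case: unpickle => [[[a b] c]|]; last by rewrite normr0.
  have h : normc (As k (ebasis a) b) <= C.
    apply: (le_trans (normc_coord _ _)); apply: (le_trans (AC _ _)).
    by rewrite l2norm_ebasis mulr1.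
  by case: c; apply: le_trans h; [exact: normc_ler_Re|exact: normc_ler_Im].
have [psi [psi_mono [l ul]]] := diagonal_subsequence uC.
exists psi; split=> //.
have entry a b : exists L : R[i],
    (fun k => As (psi k) (ebasis a) b) @ \oo --> (L : R[i]^o).
  exists (l (pickle (a, b, true)) +i* l (pickle (a, b, false)))%C.
  apply: cvg_complex.
    by have := ul (pickle (a, b, true)); rewrite /u pickleK.
  by have := ul (pickle (a, b, false)); rewrite /u pickleK.
(* Truncating [x] leaves a finite combination of columns, with an error at most [C] times the tail
   of [x], uniformly in [k]. *)
have coord x b : exists L : R[i],
    (fun k => As (psi k) x b) @ \oo --> (L : R[i]^o).
  apply: complex_cvg_of_approx => e e0.
  have [N hN] := tail_small x C e0.
  have /choice[L hL] : forall a : 'I_N, exists L : R[i],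
      (fun k => As (psi k) (ebasis a) b) @ \oo --> (L : R[i]^o).
    by move=> a; exact: entry.
  exists (fun k => As (psi k) (restr `I_N x) b), (\sum_(a < N) x a * L a).
    have -> : (fun k => As (psi k) (restr `I_N x) b) =
        fun k => \sum_(a < N) x a * As (psi k) (ebasis a) b.
      apply/funext => k; rewrite restr_II (linear_map_sumZ (Al _)) l2sum.
      by apply: eq_bigr => a _; rewrite l2Z.
    exact: complex_cvg_lincomb.
  move=> k; rewrite -l2B -(linear_mapB (Al _)).
  apply: (le_trans (normc_coord _ _)); exact: le_trans (AC _ _) hN.
have /choice[L hL] : forall xb : l2 R * nat, exists L : R[i],
    (fun k => As (psi k) xb.1 xb.2) @ \oo --> (L : R[i]^o).
  by move=> [x b]; exact: coord.
have /choice[A hA] : forall x, exists Ax : l2 R,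
    (forall b, Ax b = L (x, b)) /\ l2norm Ax <= C * l2norm x.
  move=> x.
  have [|n|Ax] := @l2_of_bounded_partial_sums _ (fun b => L (x, b)) (C * l2norm x).
  - by rewrite mulr_ge0 ?l2norm_ge0.
  - rewrite -(l2norm_finite_sum (fun b : 'I_n => L (x, b : nat))).
    rewrite ler_sqr ?nnegrE ?l2norm_ge0 ?mulr_ge0 ?l2norm_ge0//.
    (* [|y| - C |x|] is at most a finite sum of coordinate errors tending to 0, hence is
       nonpositive. *)
    set y := \sum_(j < n) _; rewrite -subr_le0.
    have yc : \sum_(b < n) normc (L (x, b : nat) - As (psi k) x b) @[k --> \oo] --> (0 : R).
      by apply: cvg0_sum => b _; apply/complex_cvg0P; exact: (hL (x, b : nat)).
    apply: (le_of_cvg0 yc); apply: nearW => k; rewrite lerBlDr.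
    apply: (@le_trans _ _ (l2norm (y - restr `I_n (As (psi k) x)) +
                           l2norm (restr `I_n (As (psi k) x)))).
      by apply: le_trans (l2normD _ _); rewrite subrK.
    apply: lerD; last exact: le_trans (l2norm_restr _ _) (AC _ _).
    rewrite /y restr_II -sumrB; apply: (le_trans (l2norm_sum _ _ _)).
    apply: ler_sum => b _.
    by rewrite -scalerBl l2normZ l2norm_ebasis mulr1.
  - by exists Ax.
have Acoord x b : (fun k => As (psi k) x b) @ \oo --> (A x b : R[i]^o).
  by rewrite (hA x).1; exact: (hL (x, b)).
have AC' x : l2norm (A x) <= C * l2norm x by case: (hA x).
have Alin : linear A.
  move=> a x y; apply: l2P => b; apply: complex_cvg_unique (Acoord _ b) _.
  have -> : (fun k => As (psi k) (a *: x + y) b) =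
      fun k => a * As (psi k) x b + As (psi k) y b.
    by apply/funext => k; rewrite Al.
  by rewrite l2D l2Z; exact: complex_cvg_linear.
exists A; split=> // x y; apply/complex_cvg0P.
apply: cvg0_of_approx => [k|e e0]; first exact: normc_ge0.
(* The factor bounds [|A x - As (psi k) x|] for all [k], so that only finitely many coordinates of
   [y] remain to be treated. *)
have [N hN] := tail_small y (C * l2norm x + C * l2norm x) e0.
exists (fun k => normc (dot (A x) (restr `I_N y) - dot (As (psi k) x) (restr `I_N y))).
  apply/complex_cvg0P; rewrite restr_II.
  have dE z : dot z (\sum_(j < N) y j *: ebasis j) = \sum_(j < N) (y j)^*%C * z j.
    by rewrite dot_sumr; apply: eq_bigr => j _; rewrite dotZr dot_ebasis.
  rewrite dE; under eq_fun do rewrite dE.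
  exact: (@complex_cvg_lincomb N xpredT (fun j => (y j)^*%C)
    (fun j k => As (psi k) x j) (fun j => A x j)).
move=> k; have -> : dot (A x) y - dot (As (psi k) x) y =
    dot (A x - As (psi k) x) (y - restr `I_N y) +
    (dot (A x) (restr `I_N y) - dot (As (psi k) x) (restr `I_N y)).
  by rewrite -!dotBl dotBr subrK.
apply: (le_trans (le_normcD _ _)); rewrite lerD2r; apply: le_trans hN.
apply: (le_trans (cauchy_schwarz _ _)); rewrite ler_wpM2r ?l2norm_ge0//.
apply: (le_trans (l2normD _ _)); rewrite l2normN.
by apply: lerD; [exact: AC'|exact: AC].
Qed.

(* Weak convergence is coordinatewise, hence in norm on a finite-dimensional
   range. *)
Lemma sot_of_wot As (A : l2 R -> l2 R) (C : R) : (forall k, linear (As k)) ->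
  linear A -> (forall k x, l2norm (As k x) <= C * l2norm x) ->
  (forall x, l2norm (A x) <= C * l2norm x) -> wot_cvg As A ->
  (forall j, exists K, forall k, supp `I_K (As k (ebasis j))) -> sot_cvg As A.
Proof.
move=> Al Alin AC AC' AsA fin.
have coord x b : normc (A x b - As k x b) @[k --> \oo] --> (0 : R).
  have /complex_cvg0P := AsA x (ebasis b).
  rewrite dot_ebasis; have -> // : (fun k => normc (A x b - dot (As k x) (ebasis b))) =
    fun k => normc (A x b - As k x b).
  by apply/funext => k; rewrite dot_ebasis.
have basis j : l2norm (A (ebasis j) - As k (ebasis j)) @[k --> \oo] --> (0 : R).
  have [K hK] := fin j.
  (* The coordinates from [K] on vanish for every [k], hence also in the limit, and the difference
     has only [K] coordinates. *)
  have AK : supp `I_K (A (ebasis j)).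
    move=> i iK; apply: Normc.eq0_normc; apply/eqP; rewrite eq_le normc_ge0 andbT.
    apply: (le_of_cvg0 (coord (ebasis j) i)); apply: nearW => k.
    by rewrite (hK k)// subr0.
  apply: (squeeze0 _ (@cvg0_sum _ _ (index_enum 'I_K) xpredT _
    (fun i : 'I_K => fun _ => coord (ebasis j) i))).
  apply: nearW => k; rewrite l2norm_ge0 /=.
  have -> : A (ebasis j) - As k (ebasis j) = restr `I_K (A (ebasis j) - As k (ebasis j)).
    by rewrite restr_id//; apply: suppB.
  rewrite restr_II; apply: (le_trans (l2norm_sum _ _ _)); apply: ler_sum => i _.
  by rewrite l2normZ l2norm_ebasis mulr1 l2B.
move=> x; apply/l2_cvgP; apply: cvg0_of_approx => [k|e e0]; first exact: l2norm_ge0.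
have [N hN] := tail_small x (C + C) e0.
exists (fun k => \sum_(j < N) l2norm (A (ebasis j) - As k (ebasis j)) * normc (x j)).
  by apply: cvg0_sum => j _; exact: cvg0Mr.
move=> k; have -> : A x - As k x = (A (x - restr `I_N x) - As k (x - restr `I_N x)) +
    (A (restr `I_N x) - As k (restr `I_N x)).
  rewrite (linear_mapB Alin) (linear_mapB (Al k)) opprB addrACA subrK.
  by rewrite [_ - _ - _]addrAC subrr sub0r.
apply: (le_trans (l2normD _ _)); apply: lerD.
  apply: le_trans hN; rewrite mulrDl; apply: (le_trans (l2normD _ _)).
  by rewrite l2normN lerD.
rewrite restr_II (linear_map_sumZ Alin) (linear_map_sumZ (Al k)) -sumrB.
apply: (le_trans (l2norm_sum _ _ _)); apply: ler_sum => j _.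
by rewrite -scalerBr l2normZ mulrC.
Qed.

End WeakCompactness.

(** * Block decomposition of the limits *)

Section BlockDecomposition.
Variable R : realType.
Implicit Types (x y z : l2 R) (A T U : l2 R -> l2 R) (D J : set nat).
Local Notation normc := (@Normc.normc R).

(** By linearity the claim holds for truncations of [x]; boundedness makes the contribution of the
    remaining tail arbitrarily small. *)
Lemma bounded_supp A D D' x : bounded_operator A ->
  (forall i, D i -> supp D' (A (ebasis i))) -> supp D x -> supp D' (A x).
Proof.
move=> [Al [C AC]] AD xD k kD'; apply: Normc.eq0_normc; apply/eqP.
rewrite eq_le normc_ge0 andbT; apply/ler_addgt0Pr => e e0; rewrite add0r.
have [N hN] := tail_small x C e0.
have AN : A (restr `I_N x) k = 0.
  rewrite restr_II (linear_map_sumZ Al) l2sum big1// => j _; rewrite l2Z.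
  have [Dj|nDj] := pselect (D j); first by rewrite (AD _ Dj)// mulr0.
  by rewrite xD// mul0r.
have -> : A x k = A (x - restr `I_N x) k.
  by rewrite (linear_mapB Al) l2B AN subr0.
apply: (le_trans (normc_coord _ _)); exact: le_trans (AC _) hN.
Qed.

(** The partial sums are [A] applied to partial expansions of [x] along [p], which converge in norm
    to the restriction of [x]. *)
Lemma tensor_sum_restr J (p : nat -> nat) (v : nat -> l2 R) A : bounded_operator A ->
  set_inj J p -> (forall j, J j -> v j = ebasis (p j)) ->
  tensor_sum J (A \o v) v (A \o restr (p @` J)).
Proof.
move=> Ab pinj vp; split; first exact: linear_bounded_comp Ab (@restr_bounded R _).
case: (Ab) => Al [C AC] x; apply/l2_cvgP.
apply: (squeeze0 _ (cvg0Mr C (restr_partial_sum_cvg x pinj))).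
apply: nearW => n; rewrite l2norm_ge0 /=.
have -> : \sum_(j < n | (j : nat) \in J) tensor ((A \o v) j) (v j) x =
    A (\sum_(j < n | (j : nat) \in J) x (p j) *: ebasis (p j)).
  rewrite (linear_map_sumZ Al); apply: eq_bigr => j /set_mem Jj.
  by rewrite /tensor /= vp// dot_ebasis.
by rewrite -(linear_mapB Al) mulrC; exact: AC.
Qed.

(** The definition of a unitary supplies an adjoint, so the choice made by [get] is a genuine
    one. *)
Lemma adjointP U : unitary_operator U -> is_adjoint U (adjoint U).
Proof. by move=> [_ [A [UA _ _]]]; apply: getPex; exists A. Qed.

Lemma dot_adjointl U x y : unitary_operator U ->
  dot (adjoint U x) y = dot x (U y).
Proof. by move=> Uu; rewrite dotC -(adjointP Uu) -dotC. Qed.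

Lemma adjoint_linear U : unitary_operator U -> linear (adjoint U).
Proof.
move=> Uu a x y; apply: l2P => i; rewrite -!dot_ebasis dotDl dotZl.
by rewrite !dot_adjointl// dotDl dotZl.
Qed.

Lemma adjoint_unitary_le U x : unitary_operator U -> l2norm (adjoint U x) <= l2norm x.
Proof.
move=> Uu; rewrite -(unitary_norm _ Uu); apply: l2norm_le_of_dot.
by rewrite (unitary_dot _ _ Uu) [RHS](adjointP Uu).
Qed.

Lemma unitary_conj_linear T U : linear T -> unitary_operator U ->
  linear (adjoint U \o T \o U).
Proof.
by move=> Tl Uu a x y; rewrite /= (unitary_linear Uu) Tl (adjoint_linear Uu).
Qed.

Lemma unitary_conj_le T U (C : R) x : (forall y, l2norm (T y) <= C * l2norm y) ->
  unitary_operator U -> l2norm ((adjoint U \o T \o U) x) <= C * l2norm x.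
Proof.
move=> TC Uu; apply: (le_trans (adjoint_unitary_le _ Uu)).
by rewrite -(unitary_norm x Uu); exact: TC.
Qed.

Lemma unitary_conj_coord T U x i : unitary_operator U ->
  (adjoint U \o T \o U) x i = dot (T (U x)) (U (ebasis i)).
Proof. by move=> Uu; rewrite -dot_ebasis dot_adjointl. Qed.

Lemma bounded_operator_pos T : bounded_operator T ->
  exists2 C : R, 0 <= C & forall x, l2norm (T x) <= C * l2norm x.
Proof.
move=> [_ [C hC]]; exists `|C| => // x; apply: (le_trans (hC x)).
by rewrite ler_wpM2r ?l2norm_ge0// ler_norm.
Qed.

(* The entries between the two index blocks vanish in the limit, so every weak
   limit of a subsequence is block diagonal. *)
Lemma subseq_cvg_of_entries T (Q_ : nat -> l2 R -> l2 R) M (ehat : nat -> l2 R)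
    (p : nat -> nat) (cvg_op : (nat -> l2 R -> l2 R) -> (l2 R -> l2 R) -> Prop) :
  bounded_operator T -> (forall n, unitary_operator (Q_ n)) ->
  set_inj (below M) p -> (forall j, below M j -> ehat j = ebasis (p j)) ->
  (forall i j, (p @` below M) i <-> ~ (p @` below M) j ->
    dot (T (Q_ n (ebasis i))) (Q_ n (ebasis j)) @[n --> \oo] --> (0 : R[i]^o)) ->
  (forall (phi : nat -> nat) A C, {homo phi : m n / (m < n)%N} ->
    let B k := adjoint (Q_ (phi k)) \o T \o Q_ (phi k) in
    linear A -> (forall x, l2norm (A x) <= C * l2norm x) ->
    (forall k x, l2norm (B k x) <= C * l2norm x) -> wot_cvg B A -> cvg_op B A) ->
  subseq_cvg cvg_op T Q_ M ehat.
Proof.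
move=> Tb Qu pinj eh entries upgrade; rewrite /subseq_cvg; cbv zeta.
move=> phi phi_mono.
have [C C0 TC] := bounded_operator_pos Tb.
have Bl k : linear (adjoint (Q_ (phi k)) \o T \o Q_ (phi k)).
  by apply: unitary_conj_linear => //; case: Tb.
have BC k x : l2norm ((adjoint (Q_ (phi k)) \o T \o Q_ (phi k)) x) <= C * l2norm x.
  exact: unitary_conj_le.
have [psi [psi_mono [A [Al AC BA]]]] := wot_subsequence Bl BC.
exists psi; split=> //.
have phipsi_mono : {homo phi \o psi : m n / (m < n)%N}.
  by move=> m n mn; apply/phi_mono/psi_mono.
have Ab : bounded_operator A by split=> //; exists C.
set S := p @` below M in entries *.
have phipsi_cvg : (phi \o psi) n @[n --> \oo] --> \oo.
  have ge n : (n <= (phi \o psi) n)%N.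
    by elim: n => // n IH; apply: (leq_ltn_trans IH); exact: phipsi_mono.
  move=> F [N _ NF]; exists N => // n /= Nn; apply: NF => /=.
  exact: leq_trans Nn (ge n).
(* The hypothesis says that exactly one of [i] and [j] lies in [S]. Weak convergence carries the
   vanishing of such entries to [A]. *)
have A0 i j : S i <-> ~ S j -> A (ebasis i) j = 0.
  move=> ij; apply: (complex_cvg_unique (u := fun k => (adjoint (Q_ (phi (psi k)))
      \o T \o Q_ (phi (psi k))) (ebasis i) j)).
    have := BA (ebasis i) (ebasis j); rewrite dot_ebasis.
    by under eq_fun do rewrite dot_ebasis.
  under eq_fun do rewrite unitary_conj_coord//.
  have /complex_cvgP h := entries i j ij.
  by apply/complex_cvgP => e /h; exact: phipsi_cvg.
have ThetaE : [set i | ~ (ehat @` below M) (ebasis i)] = ~` S.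
  apply/seteqP; split=> i /= h; apply: contra_not h.
    by move=> [j Mj pj]; exists j => //; rewrite eh// pj.
  by move=> [j Mj]; rewrite eh// => /ebasis_inj; exists j.
have VE : closure (lspan (below M) ehat) = supp S.
  exact: closure_lspan_ebasis eh.
have WE : closure (lspan (~` S) (@ebasis R)) = supp (~` S).
  have := @closure_lspan_ebasis R (~` S) ebasis id; rewrite image_id; exact.
rewrite ThetaE VE WE.
have AS i : S i -> supp S (A (ebasis i)).
  by move=> Si j Sj; apply: A0.
have AnS i : ~ S i -> supp (~` S) (A (ebasis i)).
  by move=> Si j /contrapT Sj; apply: A0.
(* The vectors [xi] and [zeta] are the columns of the weak limit, and the two summands are its
   restrictions to the two blocks. *)
exists (A \o ehat), (A \o ebasis), (A \o restr S), (A \o restr (~` S)), A.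
split=> //.
- by move=> j Mj; rewrite /= eh//; apply: AS; exists j.
- split; first exact: tensor_sum_restr.
  have := @tensor_sum_restr (~` S) id (@ebasis R) A Ab.
  by rewrite image_id; apply.
- split => //; split.
  + move=> x xS /=; apply: (bounded_supp Ab AS); exact: restr_supp.
  + move=> x xS /=; apply: (bounded_supp Ab AnS); exact: restr_supp.
  + by move=> v w vS wS; rewrite /= !restr_id// (linear_mapD Al).
- exact: upgrade AC (fun k => BC (psi k)) BA.
Qed.

End BlockDecomposition.

(** * Subspace distances and dimensions *)

Lemma bounded_on_II (p : nat -> nat) k : exists m, forall j, (j < k)%N -> (p j < m)%N.
Proof.
exists (\max_(j < k) (p j).+1) => j jk.
exact: (@leq_bigmax_cond _ xpredT (fun j : 'I_k => (p j).+1) (Ordinal jk)).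
Qed.

Lemma finite_set_sub_II (A : set nat) : finite_set A -> exists m, A `<=` `I_m.
Proof.
move=> /finite_seqP[s ->]; elim: s => [|a s [m IH]]; first by exists 0%N.
exists (maxn a.+1 m) => i /=; rewrite inE => /orP[/eqP ->|/IH /= im].
  by rewrite leq_max ltnSn.
by rewrite leq_max im orbT.
Qed.

Section SubspaceDistance.
Variable R : realType.
Implicit Types (V W : set (l2 R)).

Lemma eqO_of_bound (f g : nat -> R) (C : R) : 0 <= C ->
  (\forall n \near \oo, 0 <= f n <= C * g n) -> f =O_\oo g.
Proof.
(* [C] may be 0, while the constant of a big O has to be positive. *)
move=> C0 fg; apply/eqO_exP; exists (C + 1); first by rewrite ltr_wpDl.
apply: filterS fg => n /andP[f0 fC]; rewrite ger0_norm//; apply: (le_trans fC).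
have := ler_norm (g n); have := normr_ge0 (g n); nra.
Qed.

Lemma subspace_delta_bounds V W (c : R) : 0 <= c ->
  (forall x, V x -> l2norm x = 1 -> exists2 y, W y & l2norm (x - y) <= c) ->
  0 <= subspace_delta V W <= c.
Proof.
move=> c0 VW; rewrite /subspace_delta; set E := (X in sup X).
(* A zero subspace has no unit vector; the supremum of the empty set is then 0 by convention. *)
have [->|/set0P[e Ee]] := eqVneq E set0; first by rewrite sup0 lexx.
have Ebound s : E s -> 0 <= s <= c.
  move=> [x [Vx x1] <-]; have [y Wy xy] := VW x Vx x1.
  have lb0 : lbound [set l2norm (x - z) | z in W] 0.
    by move=> _ [z _ <-]; exact: l2norm_ge0.
  apply/andP; split.
    by apply: lb_le_inf => //; exists (l2norm (x - y)), y.
  apply: le_trans xy; apply: ge_inf; [by exists 0|by exists y].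
have supE : has_sup E.
  by split; [exists e|exists c => s /Ebound /andP[]].
apply/andP; split.
  by apply: le_trans (ub_le_sup supE.2 Ee); case/andP: (Ebound e Ee).
by apply: ge_sup => [|s /Ebound /andP[]]; first by exists e.
Qed.

End SubspaceDistance.

(** * The number of pivots and the rank of [P] *)

Section Dimension.
Variable R : realType.
Variable P : l2 R -> l2 R.
Hypotheses (P_lin : linear P) (P_idem : forall x, P (P x) = P x).
Hypothesis P_adj : is_adjoint P P.
Local Notation S := (pivots P).

Lemma pivots_lin_indep k (q : nat -> nat) : set_inj `I_k q ->
  (forall j, (j < k)%N -> S (q j)) ->
  lin_indep `I_k (fun j => P (ebasis (q j))).
Proof.
move=> qinj qS; apply/lin_indep_free => c.
have [m qm] := bounded_on_II q k.
rewrite -(linear_map_sumZ P_lin) => /(@pivot_independence _ _ P_lin m) c0 j jk _.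
have /(congr1 (fun x : l2 R => x (q j))) :
    \sum_(i < k | (i : nat) \in setT) c i *: ebasis (q i) = 0 :> l2 R.
  by apply: c0; apply: supp_sum => i _; apply/suppZ/supp_ebasis; split;
    [exact: qm|exact: qS].
rewrite /= l20 l2sum (bigD1 (Ordinal jk)) ?in_setT//= l2Z ebasisE eqxx mulr1.
rewrite big1 ?addr0// => i /andP[_ ij].
rewrite l2Z ebasisE; case: eqP => [qij|]; rewrite ?mulr0//.
by case/negP: ij; apply/eqP/val_inj/esym/qinj => //; apply/mem_set => /=.
Qed.

Lemma pivots_lspan k (q : nat -> nat) : set_inj `I_k q -> q @` `I_k = S ->
  forall w, P w = w -> lspan `I_k (fun j => P (ebasis (q j))) w.
Proof.
move=> qinj qS w Pw; have [m qm] := bounded_on_II q k.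
have Sm : S `<=` `I_m by rewrite -qS => _ [j jk <-]; exact: qm.
have [g gm <-] := pivot_spans P_lin P_idem P_adj Sm Pw.
exists k, (g \o q); rewrite -(linear_map_sumZ P_lin) -restr_partial_sum// setIid qS.
by rewrite restr_id//; apply: supp_sub gm => i [].
Qed.

Lemma rangeP w : range P w <-> P w = w.
Proof. by split=> [[x _ <-]|<-]; [exact: P_idem|exists w]. Qed.

Lemma lin_indep_range_le k m (v : nat -> l2 R) : has_dim (range P) (Some m) ->
  lin_indep `I_k v -> (forall j, (j < k)%N -> P (v j) = v j) -> (k <= m)%N.
Proof.
move=> [u _ uP] vk Pv; apply: (lin_indep_le_dim (v := u) vk) => j /Pv Pvj.
by rewrite uP; apply/rangeP.
Qed.

(** The projections of the pivot vectors are independent and, if finite in number, span the range of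
    [P]; comparing dimensions gives [M]. Infinitely many pivots are enumerated by all of [nat], and
    a finite rank is then impossible. *)
Lemma pivots_enum M : has_dim (range P) M ->
  exists2 p : nat -> nat, set_inj (below M) p & p @` below M = S.
Proof.
move=> PM.
have [[k /card_esym /card_set_bijP[q [qfun qinj qsurj]]]|Sinf] :=
    pselect (exists k, (S #= `I_k)%card).
  have qS : q @` `I_k = S.
    by apply/seteqP; split => [_ [j jk <-]|//]; exact: qfun.
  suff <- : Some k = M by exists q.
  have Pq : lin_indep `I_k (fun j => P (ebasis (q j))).
    by apply: pivots_lin_indep => // j jk; exact: qfun.
  case: M PM => [m PM|PM].
    congr Some; apply/eqP; rewrite eqn_leq (lin_indep_range_le PM Pq)//=.
    have [v vm vP] := PM; apply: (lin_indep_le_dim (v := fun j => P (ebasis (q j))) vm) => j jm.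
    by apply: pivots_lspan => //; apply/rangeP; rewrite -vP; exact: lspan_mem.
  have [v vm vP] := PM k.+1; suff : (k.+1 <= k)%N by rewrite ltnn.
  apply: (lin_indep_le_dim (v := fun j => P (ebasis (q j))) vm) => j jm.
  by apply: pivots_lspan => //; apply/rangeP/vP; exact: lspan_mem.
have /card_esym/card_set_bijP[q [qfun qinj qsurj]] : (S #= [set: nat])%card.
  by apply: eq_card_nat => [|/finite_setP//]; exact: countableP.
have qS : q @` setT = S.
  by apply/seteqP; split => [_ [j jk <-]|//]; exact: qfun.
case: M PM => [m PM|_]; last by exists q.
suff : (m.+1 <= m)%N by rewrite ltnn.
apply: (lin_indep_range_le PM (v := fun j => P (ebasis (q j)))) => [|j _//].
apply: pivots_lin_indep => [i j _ _ ij|j _]; last exact: qfun.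
by apply: qinj ij; exact: in_setT.
Qed.

(** A non-pivot below [M] would give a linear relation between the projections. For finite rank [m],
    a pivot beyond the first [m] indices would give [m + 1] independent vectors in the range. *)
Lemma below_pivots M : has_dim (range P) M ->
  lin_indep (below M) (fun l => P (ebasis l)) -> below M = S.
Proof.
move=> PM ind.
have sub : below M `<=` S.
  move=> l Ml [g gl Pg].
  have belowM j : (j <= l)%N -> below M j.
    by case: M Ml {PM ind} => //= m lm jl; exact: leq_ltn_trans lm.
  pose c j : R[i] := if j == l then 1 else - g j.
  have := ind l.+1 c _ l (ltnSn l) Ml; rewrite /c eqxx => c1.
  suff /eqP : (1 : R[i]) = 0 by rewrite oner_eq0.
  apply: c1; rewrite (eq_bigl xpredT) => [|j]; last first.
    by apply/mem_set/belowM; rewrite -ltnS.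
  have gE : P g = \sum_(j < l) g j *: P (ebasis j).
    by rewrite -{1}(restr_id gl) restr_II (linear_map_sumZ P_lin).
  rewrite big_ord_recr /= eqxx scale1r Pg gE -big_split big1//= => j _.
  by rewrite ltn_eqF// scaleNr addNr.
apply/seteqP; split=> // i Si.
case: M PM ind sub => //= m PM _ sub; apply: contrapT => /negP; rewrite -leqNgt => mi.
suff : (m.+1 <= m)%N by rewrite ltnn.
pose q j := if (j < m)%N then j else i.
apply: (lin_indep_range_le PM (v := fun j => P (ebasis (q j)))) => [|j _//].
apply: pivots_lin_indep => [j k|j _]; last first.
  by rewrite /q; case: ifP => // jm; exact: sub.
move=> /set_mem /= jm /set_mem /= km; rewrite /q.
case: ifP => jm'; case: ifP => km' // jk.
- by rewrite jk ltnNge mi in jm'.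
- by rewrite -jk ltnNge mi in km'.
- have eq_m x : (x < m.+1)%N -> (x < m)%N = false -> x = m.
    by rewrite ltnS leq_eqVlt => /orP[/eqP //|->].
  by rewrite (eq_m j)// (eq_m k).
Qed.

End Dimension.

(** * Convergence of the algorithm *)

Section Estimates.
Variable R : realType.
Variables (T P : l2 R -> l2 R) (Q_ R_ : nat -> l2 R -> l2 R) (alpha beta : R).
Hypotheses (T_lin : linear T) (T_inj : forall x, T x = 0 -> x = 0).
Hypotheses (T_surj : forall y, exists x, T x = y).
Hypothesis QR_T : QR_sequences T Q_ R_.
Hypotheses (P_lin : linear P) (P_idem : forall x, P (P x) = P x).
Hypothesis P_adj : is_adjoint P P.
Hypothesis TP : forall x, T (P x) = P (T x).
Hypotheses (beta_gt0 : 0 < beta) (beta_lt_alpha : beta < alpha).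
Hypothesis T_lower : forall x, alpha * l2norm (P x) <= l2norm (T (P x)).
Hypothesis T_upper : forall x : l2 R, l2norm (T (x - P x)) <= beta * l2norm (x - P x).
Implicit Types (x y z g w : l2 R).
Local Notation normc := (@Normc.normc R).
Local Notation S := (pivots P).

Definition rate (n : nat) : R := beta ^+ n / alpha ^+ n.

Let alpha_gt0 : 0 < alpha. Proof. exact: lt_trans beta_lt_alpha. Qed.

Lemma rate_ge0 n : 0 <= rate n.
Proof. by rewrite divr_ge0 ?exprn_ge0 ?ltW. Qed.

Lemma rate_cvg0 : rate n @[n --> \oo] --> (0 : R).
Proof.
have -> : rate = fun n => (beta / alpha) ^+ n.
  by apply/funext => n; rewrite /rate expr_div_n.
apply: cvg_expr; rewrite ger0_norm ?divr_ge0 ?ltW//.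
by rewrite ltr_pdivrMr// mul1r.
Qed.

Lemma iter_proj n x : iter n T (P x) = P (iter n T x).
Proof. by elim: n => //= n ->; rewrite TP. Qed.

Lemma iter_lower n x : alpha ^+ n * l2norm (P x) <= l2norm (iter n T (P x)).
Proof.
elim: n => [|n IH]; first by rewrite expr0 mul1r.
rewrite exprS -mulrA /= iter_proj; apply: le_trans (T_lower _).
by rewrite ler_pM2l// -iter_proj.
Qed.

Lemma iter_upper n x : l2norm (iter n T (x - P x)) <= beta ^+ n * l2norm (x - P x).
Proof.
elim: n => [|n IH]; first by rewrite expr0 mul1r.
have Tx : iter n T (x - P x) = iter n T x - P (iter n T x).
  by rewrite (linear_mapB (iter_linear T_lin n)) iter_proj.
rewrite exprS -mulrA /=; apply: (@le_trans _ _ (beta * l2norm (iter n T (x - P x)))).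
  by rewrite Tx; exact: T_upper.
by rewrite ler_pM2l.
Qed.

(* Write [Q_n e_p = T^n (g + nu)] with [P nu = 0], [nu] below [p] and [g]
   supported on the pivots. The part [T^n g] is close to the range of [P],
   and [T^n nu] is orthogonal both to [Q_n e_p] and to the range of [P]. *)
Lemma pivot_estimate p : S p -> exists2 C : R, 0 <= C &
  forall n, l2norm (Q_ n (ebasis p) - P (Q_ n (ebasis p))) <= C * rate n.
Proof.
move=> Sp; have [K K0 hK] := pivot_lower_bound P_lin p.+1.
exists K => // n; set x := Q_ n (ebasis p).
have [y ym xE] : exists2 y, supp `I_p.+1 y & x = iter n T y.
  by apply: (QR_iter_of T_inj QR_T); apply: supp_ebasis => /=.
have [y' y'p yE] := supp_IIS_setT ym.
have [g' g'p Pg'] := pivot_reduction P_lin y'p.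
pose g := g' + y p *: ebasis p; pose nu := y' - g'.
have gp : supp (`I_p.+1 `&` S) g.
  apply: suppD; first exact: supp_II_le g'p.
  by apply/suppZ/supp_ebasis; split => /=.
have nup : supp `I_p nu by apply: suppB => //; apply: supp_sub g'p => i [].
have Pnu : P nu = 0 by rewrite (linear_mapB P_lin) Pg' subrr.
have {yE}yE : y = g + nu by rewrite yE /g /nu [RHS]addrC addrA subrK.
pose w := iter n T nu.
have {}xE : x = iter n T g + w by rewrite xE yE (linear_mapD (iter_linear T_lin n)).
have Pw : P w = 0 by rewrite -iter_proj Pnu (linear_map0 (iter_linear T_lin n)).
have xw : dot x w = 0.
  have [u up wE] := QR_of_iter QR_T n nup.
  rewrite /w wE (unitary_dot _ _ (QR_unitary QR_T n)) dotC dot_ebasis up ?conjc0//.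
  by rewrite /= ltnn.
have Px : P x = P (iter n T g) by rewrite xE (linear_mapD P_lin) Pw addr0.
have xPx : dot (x - P x) (x - P x) = dot (x - P x) (iter n T g - P (iter n T g)).
  have -> : x - P x = iter n T g - P (iter n T g) + w by rewrite Px xE addrAC.
  rewrite [LHS]dotDr -[RHS]addr0; congr (_ + _).
  rewrite -[_ + w](_ : x - P x = _); last by rewrite Px xE addrAC.
  by rewrite dotBl xw P_adj Pw dot0r subrr.
apply: (le_trans (l2norm_le_of_dot xPx)).
rewrite -iter_proj -(linear_mapB (iter_linear T_lin n)).
apply: (le_trans (iter_upper _ _)).
(* The lower bound on pivots trades the kernel part of [g] for [P g], and
   [alpha^n |P g| <= |T^n P g| = |P x| <= 1]. *)
apply: (@le_trans _ _ (beta ^+ n * (K * l2norm (P g)))).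
  rewrite ler_pM2l ?exprn_gt0//; apply: le_trans (hK _ gp).
  exact: coproj_le.
rewrite /rate mulrCA ler_wpM2l// ler_pM2l ?exprn_gt0//.
rewrite -[leRHS]mul1r ler_pdivlMr ?exprn_gt0// mulrC.
apply: (le_trans (iter_lower n g)); rewrite iter_proj -Px.
apply: (le_trans (proj_le P_idem P_adj _)).
by rewrite /x (unitary_norm _ (QR_unitary QR_T n)) l2norm_ebasis.
Qed.

Lemma pivots_estimate m : exists2 C : R, 0 <= C &
  forall n z, supp (`I_m `&` S) z ->
    l2norm (Q_ n z - P (Q_ n z)) <= C * rate n * l2norm z.
Proof.
have /choice[C hC] : forall p, exists C : R, 0 <= C /\ (S p -> forall n,
    l2norm (Q_ n (ebasis p) - P (Q_ n (ebasis p))) <= C * rate n).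
  move=> p; have [/pivot_estimate[C C0 hC]|nS] := pselect (S p); first by exists C.
  by exists 0; split=> // /nS.
exists (\sum_(j < m) C j) => [|n z zm]; first by apply: sumr_ge0 => j _; case: (hC j).
have Ql := unitary_linear (QR_unitary QR_T n).
rewrite {1 2}(supp_sumE zm) !(linear_map_sumZ Ql) (linear_map_sumZ P_lin) -sumrB.
apply: (le_trans (l2norm_sum _ _ _)); rewrite big_mkcond !mulr_suml.
apply: ler_sum => j _; case: ifP => [/set_mem jS|_]; last first.
  by have [Cj0 _] := hC j; exact: mulr_ge0 (mulr_ge0 Cj0 (rate_ge0 n)) (l2norm_ge0 z).
rewrite -scalerBr l2normZ mulrC ler_pM ?l2norm_ge0 ?normc_ge0 ?normc_coord//.
by case: (hC j) => _ ->.
Qed.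

(** Once [C * rate n] is below 1/2, the vector [Q_n z], of norm [|z|], is within [|z|/2] of its
    projection. *)
Lemma pivots_lower m : \forall n \near \oo, forall z, supp (`I_m `&` S) z ->
  l2norm z <= 2 * l2norm (P (Q_ n z)).
Proof.
have [C C0 hC] := pivots_estimate m.
have : C * rate n @[n --> \oo] --> (0 : R).
  by have := cvg0Mr C rate_cvg0; under eq_fun do rewrite mulrC.
move=> /(@cvgrPdist_lt _ R^o)/(_ (1 / 2)); rewrite divr_gt0// => /(_ isT).
apply: filterS => n; rewrite sub0r normrN ger0_norm => [hn z zm|]; last first.
  exact: mulr_ge0 C0 (rate_ge0 n).
have h1 := hC n z zm.
have h2 := l2normB_le (Q_ n z) (P (Q_ n z)).
rewrite (unitary_norm _ (QR_unitary QR_T n)) in h2.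
have h3 : C * rate n * l2norm z <= 1 / 2 * l2norm z.
  by rewrite ler_wpM2r ?l2norm_ge0// ltW.
lra.
Qed.

(** This is the dimension count. Each [P Q_n e_k] with [k] a pivot equals [P T^n f_k] for some [f_k]
    supported on pivots. By [pivots_lower] these [f_k] are free for large [n], hence span, so that
    [g] is a combination of them. *)
Lemma pivots_transfer m : \forall n \near \oo, forall g, supp (`I_m `&` S) g ->
  exists2 z, supp (`I_m `&` S) z & P (iter n T g) = P (Q_ n z).
Proof.
have := pivots_lower m; apply: filterS => n hn.
have Ql := unitary_linear (QR_unitary QR_T n).
have /choice[f hf] : forall k, exists g, k \in `I_m `&` S ->
    supp (`I_m `&` S) g /\ P (Q_ n (ebasis k)) = P (iter n T g).
  move=> k; have [kS|kS] := boolP (k \in `I_m `&` S); last by exists 0.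
  have [km _] := set_mem kS.
  have [|y ym Qy] := @QR_iter_of _ _ _ _ T_inj QR_T n m (ebasis k).
    exact: supp_ebasis.
  have [g gm Pg] := pivot_reduction P_lin ym.
  by exists g => _; split => //; rewrite Qy -!iter_proj Pg.
have fE (c : nat -> R[i]) :
    P (Q_ n (\sum_(j < m | (j : nat) \in S) c j *: ebasis j)) =
    P (iter n T (\sum_(j < m | (j : nat) \in S) c j *: f j)).
  rewrite !(linear_map_sumZ Ql) !(linear_map_sumZ (iter_linear T_lin n)).
  rewrite !(linear_map_sumZ P_lin); apply: eq_bigr => j jS.
  by rewrite (hf j _).2//; apply/mem_set; split => //=; exact: set_mem.
have cS (c : nat -> R[i]) : supp (`I_m `&` S)
    (\sum_(j < m | (j : nat) \in S) c j *: ebasis j : l2 R).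
  by apply: supp_sum => k /set_mem kS; apply/suppZ/supp_ebasis; split => //=.
move=> g gm.
have [||c gE] := @free_spans_supp _ m S f _ _ g gm.
- by move=> k km kS; case: (hf k) => //; exact: mem_set.
- move=> c c0 j jm jS; rewrite -(@coord_sum_ebasis R m S c)//.
  have := hn _ (cS c); rewrite fE c0 (linear_map0 (iter_linear T_lin n)).
  rewrite (linear_map0 P_lin) l2norm0 mulr0 => z0.
  by rewrite (@l2norm0_eq0 R (\sum_(j < m | (j : nat) \in S) c j *: ebasis j))//;
    apply/eqP; rewrite eq_le z0 l2norm_ge0.
exists (\sum_(j < m | (j : nat) \in S) c j *: ebasis j) => //.
by rewrite fE -gE.
Qed.

(* [P Q_n e_i = P Q_n z] for a bounded [z] supported on pivots below [i], so
   [|P Q_n e_i|^2 = <P Q_n z - Q_n z, Q_n e_i>]. *)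
Lemma nonpivot_cvg0 i : ~ S i ->
  l2norm (P (Q_ n (ebasis i))) @[n --> \oo] --> (0 : R).
Proof.
move=> nS; have [C C0 hC] := pivots_estimate i.
apply: (@squeeze0 _ _ (fun n => rate n * (C * 2))); last first.
  exact: cvg0Mr rate_cvg0.
near=> n; rewrite l2norm_ge0 /=.
set q := Q_ n (ebasis i).
have qu := QR_unitary QR_T n.
have [z zi Pqz] : exists2 z, supp (`I_i `&` S) z & P q = P (Q_ n z).
  have [|y yi qE] := @QR_iter_of _ _ _ _ T_inj QR_T n i.+1 (ebasis i).
    by apply: supp_ebasis => /=.
  have [g gi Pg] := pivot_reduction P_lin yi.
  (* As [i] itself is not a pivot, [g] lives strictly below [i]; this is what makes [Q_n z]
     orthogonal to [q]. *)
  have gi' : supp (`I_i `&` S) g.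
    apply: supp_sub gi => k [/= + kS]; rewrite ltnS leq_eqVlt => /orP[/eqP ki|//].
    by rewrite ki in kS.
  have [|z zi hz] := (near (pivots_transfer i) n _) _ gi'; first by [].
  by exists z => //; rewrite -hz /q qE -!iter_proj Pg.
have z2 : l2norm z <= 2 * l2norm (P q).
  by rewrite Pqz; apply: (near (pivots_lower i) n _).
have zq : dot (Q_ n z) q = 0.
  rewrite (unitary_dot _ _ qu) dot_ebasis zi// => -[/=].
  by rewrite ltnn.
have h : l2norm (P q) ^+ 2 <= C * rate n * l2norm z.
  have -> : l2norm (P q) ^+ 2 = normc (dot (P (Q_ n z) - Q_ n z) q).
    by rewrite dotBl zq subr0 -Pqz -normc_dotxx -P_adj P_idem.
  apply: (le_trans (cauchy_schwarz _ _)).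
  by rewrite (unitary_norm _ qu) l2norm_ebasis mulr1 l2normB; exact: hC.
have [->|Pq0] := eqVneq (l2norm (P q)) 0.
  exact: mulr_ge0 (rate_ge0 n) (mulr_ge0 C0 (ler0n _ 2)).
have Pq : 0 < l2norm (P q) by rewrite lt_neqAle eq_sym Pq0 l2norm_ge0.
(* One factor [|P q|] cancels, since [|z| <= 2 |P q|]. *)
rewrite -(ler_pM2r Pq) -expr2; apply: (le_trans h).
rewrite [rate n * _]mulrCA mulrA -[leRHS]mulrA ler_wpM2l//.
exact: mulr_ge0 C0 (rate_ge0 n).
Unshelve. all: by end_near. Qed.


Lemma iter_surj n y : exists x, iter n T x = y.
Proof.
elim: n y => [|n IH] y; first by exists y.
by have [x <-] := T_surj y; have [z <-] := IH x; exists z.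
Qed.

(** [T] commutes with the self-adjoint [P], so the entry splits in two terms: one contains the
    projection of the non-pivot vector, the other the kernel part of the pivot vector. Both tend to
    0. *)
Lemma block_entry_cvg0 (C : R) i j : 0 <= C ->
  (forall x, l2norm (T x) <= C * l2norm x) -> (S i <-> ~ S j) ->
  dot (T (Q_ n (ebasis i))) (Q_ n (ebasis j)) @[n --> \oo] --> (0 : R[i]^o).
Proof.
move=> C0 TC ij.
have TCP x y : normc (dot (T x) y) <= C * l2norm x * l2norm y.
  apply: (le_trans (cauchy_schwarz _ _)).
  by rewrite ler_wpM2r ?l2norm_ge0.
have main a b : S a -> ~ S b ->
    (l2norm (P (Q_ n (ebasis b))) + l2norm (Q_ n (ebasis a) - P (Q_ n (ebasis a)))) * C
      @[n --> \oo] --> (0 : R).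
  move=> Sa Sb; apply/cvg0Mr/cvg0D; first exact: nonpivot_cvg0.
  have [K K0 hK] := pivot_estimate Sa.
  apply: (squeeze0 _ (cvg0Mr K rate_cvg0)).
  by apply: nearW => n; rewrite l2norm_ge0 mulrC hK.
have Q1 n k : l2norm (Q_ n (ebasis k)) = 1.
  by rewrite (unitary_norm _ (QR_unitary QR_T n)) l2norm_ebasis.
apply/complex_cvg0P.
have [Si|nSi] := pselect (S i).
  apply: (squeeze0 _ (main i j Si (ij.1 Si))); apply: nearW => n.
  rewrite normc_ge0 /= sub0r normcN; set q := Q_ n (ebasis i).
  have -> : dot (T q) (Q_ n (ebasis j)) =
      dot (T q) (P (Q_ n (ebasis j))) + dot (T (q - P q)) (Q_ n (ebasis j)).
    by rewrite -P_adj -TP -dotDl -(linear_mapD T_lin) addrC subrK.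
  apply: (le_trans (le_normcD _ _)); rewrite [leRHS]mulrC mulrDr; apply: lerD.
    by apply: (le_trans (TCP _ _)); rewrite Q1 mulr1.
  by apply: (le_trans (TCP _ _)); rewrite Q1 mulr1.
have Sj : S j by apply: contrapT => /ij.
apply: (squeeze0 _ (main j i Sj nSi)); apply: nearW => n.
rewrite normc_ge0 /= sub0r normcN; set q := Q_ n (ebasis i).
have -> : dot (T q) (Q_ n (ebasis j)) = dot (T (P q)) (Q_ n (ebasis j)) +
    dot (T q) (Q_ n (ebasis j) - P (Q_ n (ebasis j))).
  by rewrite dotBr -P_adj -TP addrC subrK.
apply: (le_trans (le_normcD _ _)); rewrite [leRHS]mulrC mulrDr; apply: lerD.
  by apply: (le_trans (TCP _ _)); rewrite Q1 mulr1.
by apply: (le_trans (TCP _ _)); rewrite Q1 mulr1.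
Qed.

Lemma finite_columns_supp m : finite_columns T ->
  exists K, forall x, supp `I_m x -> supp `I_K (T x).
Proof.
move=> fT; have /choice[f hf] : forall j, exists K, forall i,
    matrix_entry T i j != 0 -> (i < K)%N.
  by move=> j; have [K hK] := finite_set_sub_II (fT j); exists K => i /hK.
have [K hK] := bounded_on_II f m.
exists K => x xm; rewrite -(restr_id xm) restr_II (linear_map_sumZ T_lin).
apply: supp_sum => j _; apply: suppZ => i iK.
rewrite -dot_ebasis; apply: contrapT => /eqP /hf ifj; apply: iK => /=.
by apply: (ltn_trans ifj); exact: hK.
Qed.

(** Write [Q_n e_j = T^n y] with [y] in the first [j + 1] coordinates. Then [T Q_n e_j = T^n (T y)],
    where [T y] lies in the first [K] coordinates with [K] independent of [n], and [Q_n] maps these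
    onto a space containing it. *)
Lemma finite_columns_conj_supp j : finite_columns T ->
  exists K, forall n, supp `I_K ((adjoint (Q_ n) \o T \o Q_ n) (ebasis j)).
Proof.
move=> /(finite_columns_supp j.+1)[K hK]; exists K => n i iK.
have [|y yj Qy] := @QR_iter_of _ _ _ _ T_inj QR_T n j.+1 (ebasis j).
  by apply: supp_ebasis => /=.
have [u uK Tu] := QR_of_iter QR_T n (hK _ yj).
rewrite (unitary_conj_coord _ _ _ (QR_unitary QR_T n)) Qy -[T _]/(iter n.+1 T y).
by rewrite iterSr Tu (unitary_dot _ _ (QR_unitary QR_T n)) dot_ebasis uK.
Qed.

(** * Subspace distances and assembly of the conclusions *)

Section Conclusions.
Variables (M : option nat) (p : nat -> nat) (ehat : nat -> l2 R).
Hypotheses (T_bounded : bounded_operator T) (p_inj : set_inj (below M) p).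
Hypothesis p_im : p @` below M = S.
Hypothesis ehatE : forall j, below M j -> ehat j = ebasis (p j).

Lemma delta_to_range mu : `I_mu `<=` below M ->
  exists2 C : R, 0 <= C & forall n,
    0 <= subspace_delta (lspan `I_mu (fun j => Q_ n (ehat j))) (range P) <= C * rate n.
Proof.
move=> muM; have [m pm] := bounded_on_II p mu.
have [C C0 hC] := pivots_estimate m.
exists C => // n; apply: subspace_delta_bounds; first exact: mulr_ge0 C0 (rate_ge0 n).
move=> x /lspan_II[c xE] x1; exists (P x); first by exists x.
pose z : l2 R := \sum_(j < mu) c j *: ebasis (p j).
have xQ : x = Q_ n z.
  rewrite xE (linear_map_sumZ (unitary_linear (QR_unitary QR_T n))).
  by apply: eq_bigr => j _; rewrite ehatE//; apply: muM => /=.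
have zm : supp (`I_m `&` S) z.
  apply: supp_sum => j _; apply/suppZ/supp_ebasis; split; first exact: pm.
  by rewrite -p_im; exists j => //; apply: muM => /=.
have := hC n z zm; rewrite -xQ -(unitary_norm z (QR_unitary QR_T n)) -xQ x1 mulr1.
exact.
Qed.

(** Finite rank puts all pivots below one [N]. A unit vector [w] of the range is [T^n y] with [y] in
    the range; writing [y = P g] with [g] on pivots and transferring gives [w = P Q_n z] with
    [|z| <= 2], whence the constant [C * 2]. *)
Lemma delta_from_range m : M = Some m ->
  exists2 C : R, 0 <= C & \forall n \near \oo,
    0 <= subspace_delta (range P) (lspan `I_m (fun j => Q_ n (ehat j))) <= C * rate n.
Proof.
move=> Mm; have belowM : below M = `I_m by rewrite Mm.
have [N pN] := bounded_on_II p m.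
have SN : S `<=` `I_N by rewrite -p_im belowM => _ [j jm <-]; exact: pN.
have [C C0 hC] := pivots_estimate N.
exists (C * 2); first by rewrite mulr_ge0.
near=> n; apply: subspace_delta_bounds.
  exact: mulr_ge0 (mulr_ge0 C0 (ler0n _ 2)) (rate_ge0 n).
move=> w wP w1; have Pw : P w = w by case: wP => x _ <-; exact: P_idem.
have [y yE] := iter_surj n w.
have Py : P y = y.
  have : iter n T (P y - y) = 0.
    by rewrite (linear_mapB (iter_linear T_lin n)) iter_proj yE Pw subrr.
  by move=> /(iter_injective T_inj)/eqP; rewrite subr_eq0 => /eqP.
have [g gN Pg] := pivot_spans P_lin P_idem P_adj SN Py.
have [z zN Pz] : exists2 z, supp (`I_N `&` S) z & w = P (Q_ n z).
  have [|z zN hz] := (near (pivots_transfer N) n _) _ gN; first by [].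
  by exists z => //; rewrite -hz -iter_proj Pg.
have z2 : l2norm z <= 2.
  have : l2norm z <= 2 * l2norm (P (Q_ n z)) by apply: (near (pivots_lower N) n _).
  by rewrite -Pz w1 mulr1.
exists (Q_ n z).
  have -> : z = \sum_(j < m | (j : nat) \in `I_m) z (p j) *: ebasis (p j).
    rewrite -restr_partial_sum ?setIid; last by rewrite -belowM.
    rewrite restr_id// -[X in p @` X]belowM p_im.
    by apply: supp_sub zN => i [].
  rewrite (linear_map_sumZ (unitary_linear (QR_unitary QR_T n))).
  exists m, (z \o p); apply: eq_bigr => j /set_mem jm.
  by rewrite ehatE// belowM.
rewrite Pz l2normB; apply: (le_trans (hC n z zN)).
rewrite [leRHS]mulrAC ler_wpM2l//.
exact: mulr_ge0 C0 (rate_ge0 n).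
Unshelve. all: by end_near. Qed.

Lemma conclusions_of_pivots :
  [/\ forall mu : nat, `I_mu `<=` below M ->
        (fun n => subspace_delta (lspan `I_mu (fun j => Q_ n (ehat j))) (range P))
          =O_\oo (fun n => beta ^+ n / alpha ^+ n),
      forall m : nat, M = Some m ->
        (fun n => subspace_gap (lspan `I_m (fun j => Q_ n (ehat j))) (range P))
          =O_\oo (fun n => beta ^+ n / alpha ^+ n),
      subseq_cvg (@wot_cvg R) T Q_ M ehat &
      finite_columns T -> subseq_cvg (@sot_cvg R) T Q_ M ehat].
Proof.
have [C C0 TC] := bounded_operator_pos T_bounded.
have Qu n := QR_unitary QR_T n.
have entries i j : (p @` below M) i <-> ~ (p @` below M) j ->
    dot (T (Q_ n (ebasis i))) (Q_ n (ebasis j)) @[n --> \oo] --> (0 : R[i]^o).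
  by rewrite p_im; exact: block_entry_cvg0 C0 TC.
split.
- move=> mu /delta_to_range[K K0 hK]; apply: (eqO_of_bound K0); exact: nearW.
- move=> m Mm; have [|K K0 hK] := @delta_to_range m; first by rewrite Mm; exact: subset_refl.
  have [L L0 hL] := delta_from_range Mm.
  apply: (@eqO_of_bound _ _ _ (Num.max K L)); first by rewrite le_max; apply/orP; left.
  apply: filterS hL => n /andP[l0 lL]; have /andP[k0 kK] := hK n.
  rewrite /subspace_gap le_max k0 /= ge_max; apply/andP; split.
    by apply: (le_trans kK); rewrite ler_wpM2r ?rate_ge0// le_max lexx.
  by apply: (le_trans lL); rewrite ler_wpM2r ?rate_ge0// le_max lexx orbT.
- exact: (subseq_cvg_of_entries T_bounded Qu p_inj ehatE entries).
- move=> fT; apply: (subseq_cvg_of_entries T_bounded Qu p_inj ehatE entries).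
  move=> phi A K _ B Al AK BK BA; apply: (sot_of_wot _ Al BK AK BA).
    by move=> k; exact: unitary_conj_linear.
  move=> j; have [N hN] := finite_columns_conj_supp j fT.
  by exists N => k; exact: hN.
Qed.

End Conclusions.

End Estimates.

Theorem theorem3p13 (R : realType) (T P : l2 R -> l2 R) (M : option nat)
    (alpha beta : R) (Q_ R_ : nat -> l2 R -> l2 R)
    (T_bounded : bounded_operator T) (T_invertible : invertible_operator T)
    (P_proj : orthogonal_projection P) (P_rank : has_dim (range P) M)
    (T_ranP : invariant_subspace T (range P))
    (T_ranIP : invariant_subspace T (range (fun x => x - P x)))
    (beta_gt0 : 0 < beta) (beta_lt_alpha : beta < alpha)
    (T_lower : forall x, range P x -> alpha * l2norm x <= l2norm (T x))
    (T_upper : forall x, range (fun y => y - P y) x ->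
       l2norm (T x) <= beta * l2norm x)
    (QR_T : QR_sequences T Q_ R_) :
  let conclusions (ehat : nat -> l2 R) :=
    [/\ forall mu : nat, `I_mu `<=` below M ->
          (fun n => subspace_delta (lspan `I_mu (fun j => Q_ n (ehat j))) (range P))
            =O_\oo (fun n => beta ^+ n / alpha ^+ n),
        forall m : nat, M = Some m ->
          (fun n => subspace_gap (lspan `I_m (fun j => Q_ n (ehat j))) (range P))
            =O_\oo (fun n => beta ^+ n / alpha ^+ n),
        subseq_cvg (@wot_cvg R) T Q_ M ehat &
        finite_columns T -> subseq_cvg (@sot_cvg R) T Q_ M ehat] in
  (exists ehat : nat -> l2 R,
     [/\ forall j, below M j -> range ebasis (ehat j),
         set_inj (below M) ehat &
         conclusions ehat]) /\
  (lin_indep (below M) (fun l => P (ebasis l)) -> conclusions ebasis).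
Proof.
move=> conclusions.
case: P_proj => -[P_lin _] PP P_adj.
have P_idem x : P (P x) = P x by rewrite -[LHS]/((P \o P) x) PP.
case: (T_bounded) => T_lin _.
case: T_invertible => T' [[T'_lin _] T'T TT'].
have T_inj x : T x = 0 -> x = 0.
  by move=> Tx; rewrite -[x]/(id x) -T'T /= Tx (linear_map0 T'_lin).
have T_surj y : exists x, T x = y by exists (T' y); rewrite -[LHS]/((T \o T') y) TT'.
(* Invariance of the two ranges gives [P T P = T P] and [P T (I - P) = 0]; adding them shows that
   [P] and [T] commute. *)
have TP x : T (P x) = P (T x).
  have [y _ Py] : range P (T (P x)) by apply: T_ranP; exists x.
  have [z _ Pz] : range (fun y => y - P y) (T (x - P x)) by apply: T_ranIP; exists x.
  have PTP : P (T (P x)) = T (P x) by rewrite -Py P_idem.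
  have PTI : P (T (x - P x)) = 0 by rewrite -Pz (linear_mapB P_lin) P_idem subrr.
  by rewrite -{2}(subrK (P x) x) (linear_mapD T_lin) (linear_mapD P_lin) PTI PTP add0r.
have lower x : alpha * l2norm (P x) <= l2norm (T (P x)) by apply: T_lower; exists x.
have upper x : l2norm (T (x - P x)) <= beta * l2norm (x - P x).
  by apply: T_upper; exists x.
have concl p ehat : set_inj (below M) p -> p @` below M = pivots P ->
    (forall j, below M j -> ehat j = ebasis (p j)) -> conclusions ehat.
  move=> p_inj p_im ehatE; exact: (conclusions_of_pivots T_lin T_inj T_surj QR_T
    P_lin P_idem P_adj TP beta_gt0 beta_lt_alpha lower upper T_bounded p_inj p_im ehatE).
have [p p_inj p_im] := pivots_enum P_lin P_idem P_adj P_rank.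
split; last first.
  (* Under independence the pivots are exactly the indices below [M], so the identity enumerates
     them. *)
  move=> ind; apply: (concl id) => //; rewrite image_id.
  exact: (below_pivots P_lin P_idem P_rank ind).
exists (fun j => ebasis (p j)); split.
- by move=> j _; exists (p j).
- by move=> i j Mi Mj /ebasis_inj; exact: p_inj.
- exact: concl p_inj p_im _.
Qed.
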